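(* Let $\Sigma$ be a simply connected surface and let $f:\Sigma\to\mathbb{R}^4$ be a flat surface with flat normal bundle in $\mathbb{R}^4$ whose first normal space $N_1^f$ has dimension $2$ at every point. Then there exists a natural Lorentz surface structure on $\Sigma$ such that at every point $p\in\Sigma$ its null directions are the asymptotic directions of any of the special sections of $f$ that are regular at $p$.
   Context: All objects are smooth. A flat surface in $\mathbb{R}^4$ is an immersion whose induced metric is flat; it has flat normal bundle if its normal curvature tensor $R^\perp$ vanishes identically. The first normal space $N_1^f(p)$ is the span of the image of the second fundamental form of $f$ at $p$. A Lorentz surface structure on $\Sigma$ is the class of all Lorentzian metrics on $\Sigma$ conformal to a specific Lorentzian metric. A special section of $f$ is a unit normal vector field $N$ globally defined on $\Sigma$ that is parallel in the normal bundle (i.e. $dN(X)$ is tangent to $f$ for every tangent field $X$), regarded as a map $N:\Sigma\to\mathbb{S}^3$; its orthonormal complement $\hat N$ in the normal bundle is also a special section. $N$ is regular at $p$ if it is an immersion at $p$. Near such a point, $N$ is a flat surface in $\mathbb{S}^3$ with unit normal $\hat N$, whose second fundamental form is (up to sign) the Lorentzian metric $\langle dN,d\hat N\rangle$; the asymptotic directions of $N$ at $p$ are the null directions of $\langle dN,d\hat N\rangle$ at $p$. *)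

(* Defs.v *)
From HB Require Import structures.
From mathcomp Require Import all_boot all_order all_algebra.
From mathcomp Require Import all_classical all_reals all_analysis.
Set Implicit Arguments.
Unset Strict Implicit.
Unset Printing Implicit Defensive.
Import Order.TTheory GRing.Theory Num.Theory.
Import numFieldNormedType.Exports.
Local Open Scope classical_set_scope.
Local Open Scope ring_scope.

(* Vectors are row vectors and 'J F x acts on the right, so the i-th row of    *)
(* 'J F x is the i-th partial derivative of F, and a bilinear form on R^n with *)
(* matrix G is (u, v) |-> u G v^T.                                             *)

Section Euclidean.
Context {R : realType}.

Definition dot n (u v : 'rV[R]_n) : R := (u *m v^T) 0 0.

Definition bilin n (G : 'M[R]_n) (u v : 'rV[R]_n) : R := (u *m G *m v^T) 0 0.

Definition basisv (i : 'I_2) : 'rV[R]_2 := delta_mx 0 i.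

Fixpoint C_on (k : nat) (W : normedModType R) (U : set 'rV[R]_2)
    (F : 'rV[R]_2 -> W) : Prop :=
  match k with
  | 0 => forall x, U x -> {for x, continuous F}
  | k'.+1 => (forall x, U x -> differentiable F x) /\
             (forall v, C_on k' U (fun x => 'D_v F x))
  end.

Definition smooth_on (W : normedModType R) (U : set 'rV[R]_2)
    (F : 'rV[R]_2 -> W) : Prop := forall k, C_on k U F.

End Euclidean.

Section Curvature.
Context {R : realType}.
Variable g : 'rV[R]_2 -> 'M[R]_2.

Definition dmetric (i j l : 'I_2) (x : 'rV[R]_2) : R :=
  'D_(basisv i) (fun y => g y j l : R^o) x.

(* Gamma^k_ij *)
Definition christoffel (k i j : 'I_2) (x : 'rV[R]_2) : R :=
  2^-1 * \sum_(l < 2) invmx (g x) k l *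
    (dmetric i j l x + dmetric j i l x - dmetric l i j x).

(* the component R^l of R(d_i, d_j) d_k =                                      *)
(* nabla_i nabla_j d_k - nabla_j nabla_i d_k                                   *)
Definition riemann (l i j k : 'I_2) (x : 'rV[R]_2) : R :=
  'D_(basisv i) (christoffel l j k : 'rV[R]_2 -> R^o) x
  - 'D_(basisv j) (christoffel l i k : 'rV[R]_2 -> R^o) x
  + \sum_(m < 2) (christoffel m j k x * christoffel l i m x
                  - christoffel m i k x * christoffel l j m x).

End Curvature.

Section ParametrizedSurface.
Context {R : realType}.
Variable F : 'rV[R]_2 -> 'rV[R]_4.

Definition first_fundamental_form (x : 'rV[R]_2) : 'M[R]_2 :=
  'J F x *m ('J F x)^T.

Definition normal_at (x : 'rV[R]_2) (w : 'rV[R]_4) : Prop :=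
  forall u : 'rV[R]_2, dot w ('D_u F x) = 0.

Definition tangent_at (x : 'rV[R]_2) (w : 'rV[R]_4) : Prop :=
  exists u : 'rV[R]_2, w = 'D_u F x.

(* orthogonal projection onto the normal space at a point where F is immersive *)
Definition normal_proj (x : 'rV[R]_2) (w : 'rV[R]_4) : 'rV[R]_4 :=
  w - w *m ('J F x)^T *m invmx (first_fundamental_form x) *m 'J F x.

Definition second_fundamental_form (u v x : 'rV[R]_2) : 'rV[R]_4 :=
  normal_proj x ('D_u (fun y => 'D_v F y) x).

(* By bilinearity the values on the coordinate basis span the same subspace as *)
(* the whole image of the second fundamental form.                             *)
Definition first_normal_space (x : 'rV[R]_2) : {vspace 'rV[R]_4} :=
  (\sum_(i < 2) \sum_(j < 2)
     <[second_fundamental_form (basisv i) (basisv j) x]>)%VS.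

Definition normal_connection (u : 'rV[R]_2) (xi : 'rV[R]_2 -> 'rV[R]_4)
    (x : 'rV[R]_2) : 'rV[R]_4 :=
  normal_proj x ('D_u xi x).

(* u and v are constant coordinate fields, so the bracket term vanishes. *)
Definition normal_curvature (u v : 'rV[R]_2) (xi : 'rV[R]_2 -> 'rV[R]_4)
    (x : 'rV[R]_2) : 'rV[R]_4 :=
  normal_connection u (normal_connection v xi) x
  - normal_connection v (normal_connection u xi) x.

End ParametrizedSurface.

(* [of_coord] is total; only its values on [coord @` dom] are meaningful. *)
Record chart (R : realType) (T : topologicalType) := Chart {
  dom : set T;
  coord : T -> 'rV[R]_2;
  of_coord : 'rV[R]_2 -> T;
  dom_open : open dom;
  range_open : open (coord @` dom);
  coordK : forall p, dom p -> of_coord (coord p) = p;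
  coord_continuous : forall p, dom p -> {for p, continuous coord};
  of_coord_continuous :
    forall x, (coord @` dom) x -> {for x, continuous of_coord} }.

Definition transition (R : realType) (T : topologicalType) (c d : chart R T) :
    'rV[R]_2 -> 'rV[R]_2 := coord d \o of_coord c.

Record surface (R : realType) := Surface {
  carrier :> topologicalType;
  chart_index : Type;
  atlas : chart_index -> chart R carrier;
  surface_hausdorff : hausdorff_space carrier;
  surface_second_countable : @second_countable carrier;
  atlas_cover : forall p, exists i, dom (atlas i) p;
  atlas_smooth : forall i j,
    smooth_on (coord (atlas i) @` (dom (atlas i) `&` dom (atlas j)))
              (transition (atlas i) (atlas j)) }.

(* Path-connected, nonempty, and every loop is null-homotopic relative to its  *)
(* base point. Paths and homotopies are functions on R and R * R of which only *)
(* the restrictions to [0, 1] and [0, 1]^2 are used.                           *)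
Definition simply_connected (R : realType) (T : topologicalType) : Prop :=
  [/\ exists p : T, True,
      forall p q : T, exists gamma : R -> T,
        [/\ {within `[0, 1], continuous gamma}, gamma 0 = p & gamma 1 = q]
    & forall gamma : R -> T,
        {within `[0, 1], continuous gamma} -> gamma 0 = gamma 1 ->
        exists H : R * R -> T,
          [/\ {within (`[0, 1]%classic : set R) `*` (`[0, 1]%classic : set R),
                continuous H},
              forall t : R, 0 <= t <= 1 -> H (t, 0) = gamma t,
              forall t : R, 0 <= t <= 1 -> H (t, 1) = gamma 0
            & forall s : R, 0 <= s <= 1 ->
                H (0, s) = gamma 0 /\ H (1, s) = gamma 0]].

Section SurfaceNotions.
Context {R : realType} (S : surface R).

Definition domi (i : chart_index S) : set S := dom (atlas i).
Definition coordi (i : chart_index S) : S -> 'rV[R]_2 := coord (atlas i).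
Definition rangei (i : chart_index S) : set 'rV[R]_2 := coordi i @` domi i.

Definition local (W : Type) (F : S -> W) (i : chart_index S) : 'rV[R]_2 -> W :=
  F \o of_coord (atlas i).

Definition smooth (W : normedModType R) (F : S -> W) : Prop :=
  forall i, smooth_on (rangei i) (local F i).

Definition immersive_at (F : S -> 'rV[R]_4) (p : S) : Prop :=
  forall i, domi i p -> row_free ('J (local F i) (coordi i p)).

Definition immersion (F : S -> 'rV[R]_4) : Prop :=
  smooth F /\ forall p, immersive_at F p.

Definition flat_surface (f : S -> 'rV[R]_4) : Prop :=
  immersion f /\
  forall i x, rangei i x -> forall l a b c,
    riemann (first_fundamental_form (local f i)) l a b c x = 0.

Definition flat_normal_bundle (f : S -> 'rV[R]_4) : Prop :=
  forall i (xi : 'rV[R]_2 -> 'rV[R]_4),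
    smooth_on (rangei i) xi ->
    (forall x, rangei i x -> normal_at (local f i) x (xi x)) ->
    forall x, rangei i x -> forall u v,
      normal_curvature (local f i) u v xi x = 0.

Definition first_normal_dim (f : S -> 'rV[R]_4) (k : nat) (p : S) : Prop :=
  forall i, domi i p ->
    \dim (first_normal_space (local f i) (coordi i p)) = k.

(* a unit section of the normal bundle of f *)
Definition unit_normal_field (f N : S -> 'rV[R]_4) : Prop :=
  [/\ smooth N,
      forall p, dot (N p) (N p) = 1
    & forall i p, domi i p -> normal_at (local f i) (coordi i p) (N p)].

Definition special_section (f N : S -> 'rV[R]_4) : Prop :=
  unit_normal_field f N /\
  forall i x, rangei i x -> forall u,
    tangent_at (local f i) x ('D_u (local N i) x).

(* [Nh] completes [N] to an orthonormal frame of the normal bundle; it is then *)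
(* automatically parallel, hence a special section too.                        *)
Definition orthonormal_complement (f N Nh : S -> 'rV[R]_4) : Prop :=
  unit_normal_field f Nh /\ forall p, dot (N p) (Nh p) = 0.

(* A covariant 2-tensor is given by its matrices in the coordinates of all the *)
(* charts; [g i x] is meaningful only for x in [rangei i].                     *)
Definition tensor2 : Type := chart_index S -> 'rV[R]_2 -> 'M[R]_2.

Definition smooth_tensor2 (g : tensor2) : Prop :=
  (forall i, smooth_on (rangei i) (g i)) /\
  (forall i j p, domi i p -> domi j p ->
     let J := 'J (transition (atlas i) (atlas j)) (coordi i p) in
     g i (coordi i p) = J *m g j (coordi j p) *m J^T).

Definition lorentzian_metric (g : tensor2) : Prop :=
  smooth_tensor2 g /\
  forall i x, rangei i x ->
    (g i x)^T = g i x /\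
    exists u v : 'rV[R]_2,
      [/\ bilin (g i x) u u = 1, bilin (g i x) v v = -1
        & bilin (g i x) u v = 0].

Definition conformal (g h : tensor2) : Prop :=
  exists lambda : S -> R,
    [/\ smooth (lambda : S -> R^o), forall p, 0 < lambda p
      & forall i p, domi i p ->
          h i (coordi i p) = lambda p *: g i (coordi i p)].

Definition lorentz_surface_structure (L : set tensor2) : Prop :=
  exists2 g, lorentzian_metric g
    & L = [set h | lorentzian_metric h /\ conformal g h].

(* Directions at a point are represented by the coordinates of the nonzero     *)
(* vectors spanning them.                                                      *)
Definition null_directions (G : 'M[R]_2) : set 'rV[R]_2 :=
  [set v | v != 0 /\ bilin G v v = 0].

(* matrix of the form <dN, dNh> in the i-th chart *)
Definition dN_dNh (N Nh : S -> 'rV[R]_4) (i : chart_index S) (x : 'rV[R]_2) :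
    'M[R]_2 := 'J (local N i) x *m ('J (local Nh i) x)^T.

Definition asymptotic_directions (N Nh : S -> 'rV[R]_4) (i : chart_index S) (p : S) :
    set 'rV[R]_2 := null_directions (dN_dNh N Nh i (coordi i p)).

End SurfaceNotions.

(* Main.v *)
Require Import Defs.
From HB Require Import structures.
From mathcomp Require Import all_boot all_order all_algebra.
From mathcomp Require Import all_classical all_reals all_analysis.
From mathcomp Require Import ring lra.
Set Implicit Arguments.
Unset Strict Implicit.
Unset Printing Implicit Defensive.
Import Order.TTheory GRing.Theory Num.Theory.
Import numFieldNormedType.Exports.
Local Open Scope classical_set_scope.
Local Open Scope ring_scope.

(** In a chart write A = 'J f, I = A A^T, and let h_c (c < 4) be the symmetric
    2x2 matrix of the c-th component of the second fundamental form alpha.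

    The Gauss equation turns flatness into sum_c det h_c = 0, and the Ricci
    equation turns flatness of the normal bundle into the symmetry of all the
    products h_c I^-1 h_d ([gauss_equation], [ricci_equation]).  The latter
    means that the shape operators commute, so that there is an orthonormal
    tangent frame X_1, X_2 with alpha(X_1, X_2) = 0; put a = alpha(X_1, X_1) and
    b = alpha(X_2, X_2).  The Gauss equation says that a and b are orthogonal,
    and since the first normal space is a plane neither vanishes
    ([adapted_frame_exists]).  For orthonormal normal vectors N, M the form
    <dN, dM> is S_N I^-1 S_M, where S_N = sum_c N_c h_c; in the frame X it has
    the matrix diag (<a,N><a,M>, <b,N><b,M>), and orthonormality of N, M makes it
    a multiple of diag (|a|^2, - |b|^2), a nonzero one when S_N is invertible
    ([special_normal_proportional], [asymptotic_form]).  The null directions of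
    |a|^2 X_1^* ^2 - |b|^2 X_2^* ^2 are thus the asymptotic directions of every
    regular special section, and it remains to make this form into a global
    smooth tensor.

    A smooth expression that needs neither a choice of frame nor special
    sections is [lorentz_form], a double Jacobian: the Jacobian of the pencil
    spanned by the h_c is a multiple of X_1^* X_2^*, and its Jacobian with the
    third fundamental form sum_c h_c I^-1 h_c is the desired form up to a nonzero
    scalar ([lorentz_form_adapted]).  Under a change of coordinates with Jacobian
    matrix J it is multiplied by (det J)^3 ([lorentz_form_congruence]).
    Dividing by (det I)^(3/2) leaves the sign of det J, so all that is missing
    is an orientation of the surface; this is where simple connectedness enters.
    The sign of det (A(q) A(r)^T), with A taken in arbitrarily chosen charts at
    q and r, is a {1,-1}-valued cocycle on pairs of points that is a coboundary
    near the diagonal, and on a simply connected space such a cocycle is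
    globally a coboundary near the diagonal ([locally_trivial_sign_cocycle]).
    The proof transports signs along paths and uses null-homotopies to see that
    the result depends only on the end point. *)

(** * Sign cocycles on simply connected spaces *)

Section SignCocycle.
Context {R : realType}.

Lemma within_continuous_epsP (V : normedModType R) (T : topologicalType)
    (K : set V) (h : V -> T) :
  {within K, continuous h} <->
  forall x, K x -> forall W, nbhs (h x) W ->
    exists2 d : R, 0 < d & forall y, K y -> `|x - y| < d -> W (h y).
Proof.
rewrite subspace_continuousP; split=> hc x Kx W hW.
  have /nbhs_ballP[d /= d0 dW] := hc x Kx W hW.
  by exists d => // y Ky xy; apply: (dW y) => //; rewrite -ball_normE.
have [d d0 dW] := hc x Kx W hW; apply/nbhs_ballP; exists d => //= y.
by rewrite -ball_normE /= => xy Ky; exact: dW.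
Qed.

Context {T : topologicalType}.
Variable sigma : T -> T -> bool.

(** The local form of the cocycle condition, signs being encoded as booleans
    under [addb]: on U, sigma compares two values of a potential. *)
Definition trivial_on (U : set T) : Prop :=
  exists e : T -> bool, forall q r, U q -> U r -> sigma q r = e q (+) e r.

(** Trivialization over a compact star-shaped set K mapped into the space, in
    practice the unit interval or the unit square.  By compactness the map sends
    all sufficiently small balls of K into sets where sigma is trivial; the
    potential at x is the sum of sigma along n equal steps from 0 to x, and for
    nearby x and y two such sums differ by sigma (h x) (h y), because the small
    quadrilaterals between the two segments contribute nothing. *)
Lemma sign_lift (V : normedModType R) (K : set V) (h : V -> T) :
  compact K -> (forall x (t : R), K x -> 0 <= t <= 1 -> K (t *: x)) ->
  (forall p : T, exists2 U : set T, nbhs p U & trivial_on U) ->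
  {within K, continuous h} ->
  exists s : V -> bool, exists2 d : R, 0 < d &
    forall x y, K x -> K y -> `|x - y| < d -> sigma (h x) (h y) = s x (+) s y.
Proof.
move=> cK starK triv /within_continuous_epsP hc.
have [d0 d0_gt0 lebesgue] : exists2 d : R, 0 < d & forall x, K x ->
    exists2 U : set T, trivial_on U & forall y, K y -> `|x - y| < d -> U (h y).
  have ncK := (compact_near_coveringP K).1 cK.
  have := ncK R (0^'+) (fun d x => exists2 U, trivial_on U &
    forall y, K y -> `|x - y| < d -> U (h y)) _ _.
  case=> [x Kx|d /= d0 dP].
    have [U hU trivU] := triv (h x).
    have [d d0 dU] := hc x Kx U hU.
    exists (ball x (d / 2), [set e : R | e < d / 2]) => /=.
      split; first by apply: nbhsx_ballx; rewrite divr_gt0.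
      by apply: nbhs_right_lt; rewrite divr_gt0.
    move=> [x' e] /= [xx' ed]; exists U => // y Ky x'y; apply: dU => //.
    move: xx'; rewrite -ball_normE /= => xx'.
    rewrite -(subrKA x') (le_lt_trans (ler_normD _ _)) // (splitr d) ltrD //.
    exact: lt_trans x'y _.
  exists (d / 2); first by rewrite divr_gt0.
  move=> x Kx; apply: (dP (d / 2)) => //=.
    by rewrite sub0r normrN gtr0_norm ?ltr_pdivrMr ?divr_gt0 // ltr_pMr // ltr1n.
  by rewrite divr_gt0.
have [M M0 KM] : exists2 M : R, 0 < M & forall x, K x -> `|x| <= M.
  have [M [_ KM]] := compact_bounded cK; exists (`|M| + 1) => [|x Kx].
    by rewrite ltr_wpDl.
  by apply: (KM (`|M| + 1)) => //; rewrite (le_lt_trans (ler_norm M)) // ltrDl.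
pose n := (Num.truncn (2 * M / d0)).+1.
have nM : n%:R^-1 * M < d0 / 2.
  have : 2 * M / d0 < n%:R by exact: truncnS_gt.
  rewrite ltr_pdivrMr // mulrC [X in _ -> X < _]mulrC ltr_pdivrMr ?ltr0n //.
  by move=> nd; lra.
pose pt (x : V) (k : nat) : V := (k%:R / n%:R) *: x.
have ptK x k : K x -> (k <= n)%N -> K (pt x k).
  move=> Kx kn; apply: starK => //; rewrite divr_ge0 ?ler0n //=.
  by rewrite ler_pdivrMr ?ltr0n // mul1r ler_nat.
have pt_step x k : K x -> `|pt x k - pt x k.+1| < d0 / 2.
  move=> Kx; rewrite /pt -scalerBl normrZ -mulrBl -natr1 opprD addNKr.
  rewrite mulN1r normrN gtr0_norm ?invr_gt0 ?ltr0n //.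
  by rewrite (le_lt_trans _ nM) // ler_wpM2l ?KM // invr_ge0 ler0n.
have pt_near x y k : (k <= n)%N -> `|x - y| < d0 / 2 ->
    `|pt x k - pt y k| < d0 / 2.
  move=> kn xy; rewrite /pt -scalerBr normrZ (le_lt_trans _ xy) //.
  rewrite ger0_norm ?divr_ge0 ?ler0n // ler_piMl //.
  by rewrite ler_pdivrMr ?ltr0n // mul1r ler_nat.
pose s x := \big[addb/false]_(k < n) sigma (h (pt x k)) (h (pt x k.+1)).
exists s, (d0 / 2); first by rewrite divr_gt0.
move=> x y Kx Ky xy.
(* Telescoping over the quadrilaterals with corners at steps m and m+1. *)
have tele m : (m <= n)%N ->
    \big[addb/false]_(k < m) sigma (h (pt x k)) (h (pt x k.+1)) (+)
    \big[addb/false]_(k < m) sigma (h (pt y k)) (h (pt y k.+1)) =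
    sigma (h (pt x m)) (h (pt y m)).
  elim: m => [_|m IHm mn].
    rewrite !big_ord0 /pt !mul0r !scale0r.
    have [U hU [e Ue]] := triv (h 0).
    by rewrite Ue ?addbb //; exact: nbhs_singleton hU.
  have {}IHm := IHm (ltnW mn).
  have [U [e Ue] hU] := lebesgue _ (ptK x m Kx (ltnW mn)).
  have U1 : U (h (pt x m)).
    by apply: hU; rewrite ?subrr ?normr0 //; apply: ptK => //; exact: ltnW.
  have U2 : U (h (pt x m.+1)).
    apply: hU; first exact: ptK.
    by rewrite (lt_trans (pt_step _ _ Kx)) // ltr_pdivrMr // ltr_pMr // ltr1n.
  have U3 : U (h (pt y m)).
    apply: hU; first by apply: ptK => //; exact: ltnW.
    rewrite (lt_trans (pt_near x y m (ltnW mn) xy)) //.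
    by rewrite ltr_pdivrMr // ltr_pMr // ltr1n.
  have U4 : U (h (pt y m.+1)).
    apply: hU; first exact: ptK.
    rewrite -(subrKA (pt y m)) (le_lt_trans (ler_normD _ _)) // (splitr d0).
    by rewrite ltrD // ?pt_near // ?pt_step // ltnW.
  rewrite !big_ord_recr /= addbACA IHm !Ue //.
  by case: (e _) (e _) (e _) (e _) => [] [] [] [].
have := tele n (leqnn n); rewrite /pt divff ?scale1r; last by rewrite pnatr_eq0.
by move=> ->.
Qed.

End SignCocycle.

Section LiftedPaths.
Context {R : realType} {T : topologicalType}.
Variable sigma : T -> T -> bool.

(** This is continuity of t |-> (gamma t, e t) into the double covering that
    sigma defines, spelled out at each point of the unit interval. *)
Definition lifted_path (gamma : R -> T) (e : R -> bool) : Prop :=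
  forall t, 0 <= t <= 1 -> forall W, nbhs (gamma t) W ->
    exists2 d : R, 0 < d & forall u, 0 <= u <= 1 -> `|t - u| < d ->
      W (gamma u) /\ sigma (gamma t) (gamma u) = e t (+) e u.

Lemma lifted_path_continuous gamma e : lifted_path gamma e ->
  {within `[0, 1], continuous gamma}.
Proof.
move=> le; apply/within_continuous_epsP => t; rewrite /= in_itv /= => t01 W hW.
have [d d0 dP] := le t t01 W hW; exists d => // u; rewrite /= in_itv /= => u01 tu.
by have [] := dP u u01 tu.
Qed.

Lemma locally_constant_ends (e : R -> bool) :
  (forall t, 0 <= t <= 1 -> exists2 d : R, 0 < d &
     forall u, 0 <= u <= 1 -> `|t - u| < d -> e t = e u) -> e 0 = e 1.
Proof.
move=> le; have ce : {within `[0, 1], continuous (e : R -> bool)}.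
  apply/within_continuous_epsP => t; rewrite /= in_itv /= => t01 W hW.
  have [d d0 dP] := le t t01; exists d => // u; rewrite /= in_itv /= => u01 tu.
  by rewrite -(dP u u01 tu); exact: nbhs_singleton.
have := connected_continuous_connected (@segment_connected R 0 1) ce.
have i0 : (`[0, 1]%classic : set R) 0 by rewrite /= in_itv /= lexx ler01.
have i1 : (`[0, 1]%classic : set R) 1 by rewrite /= in_itv /= lexx ler01.
move=> /(_ [set e 0]) cst.
suff E : [set e 0] = [set e x | x in `[0, 1]%classic].
  by have : [set e x | x in `[0, 1]%classic] (e 1) by [exists 1]; rewrite -E.
apply: cst.
- by exists (e 0).
- exists [set e 0]; first exact: discrete_open.
  by apply/seteqP; split=> [_ ->|_ [_ ->]] //; split=> //; exact: imageP.
- exists [set e 0]; first exact: discrete_closed.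
  by apply/seteqP; split=> [_ ->|_ [_ ->]] //; split=> //; exact: imageP.
Qed.

(** The difference of two lifts is locally constant on a connected interval. *)
Lemma lifted_path_unique gamma e e' : lifted_path gamma e ->
  lifted_path gamma e' -> e 0 (+) e 1 = e' 0 (+) e' 1.
Proof.
move=> le le'; have : e 0 (+) e' 0 = e 1 (+) e' 1.
  apply: (locally_constant_ends (e := fun t => e t (+) e' t)) => t t01.
  have [d d0 dP] := le t t01 setT filterT.
  have [d' d'0 dP'] := le' t t01 setT filterT.
  exists (Order.min d d') => [|u u01]; first by rewrite lt_min d0.
  rewrite lt_min => /andP[/(dP _ u01)[_ +] /(dP' _ u01)[_]].
  by move=> ->; case: (e t) (e u) (e' t) (e' u) => [] [] [] [].
by case: (e 0) (e 1) (e' 0) (e' 1) => [] [] [] [].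
Qed.

Lemma lifted_path_add gamma e b : lifted_path gamma e ->
  lifted_path gamma (fun t => e t (+) b).
Proof.
move=> le t t01 W hW; have [d d0 dP] := le t t01 W hW; exists d => // u u01 tu.
by have [Wu ->] := dP u u01 tu; split=> //; rewrite addbACA addbb addbF.
Qed.

Lemma lifted_path_rev gamma e : lifted_path gamma e ->
  lifted_path (fun t => gamma (1 - t)) (fun t => e (1 - t)).
Proof.
have rev01 (t : R) : 0 <= t <= 1 -> 0 <= 1 - t <= 1 by move=> ?; lra.
move=> le t t01 W hW; have [d d0 dP] := le _ (rev01 t t01) W hW.
exists d => // u u01 tu; apply: dP; first exact: rev01.
by rewrite opprB addrC addrA subrK distrC.
Qed.

Definition path_join A (c1 c2 : R -> A) (t : R) : A :=
  if t <= 2^-1 then c1 (2 * t) else c2 (2 * t - 1).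

Lemma lifted_path_join gamma1 e1 gamma2 e2 :
  lifted_path gamma1 e1 -> lifted_path gamma2 e2 ->
  gamma1 1 = gamma2 0 -> e1 1 = e2 0 ->
  lifted_path (path_join gamma1 gamma2) (path_join e1 e2).
Proof.
move=> l1 l2 g12 e12 t t01 W; rewrite /path_join.
have [t_lt|t_gt|->] := ltgtP t 2^-1 => hW.
- have [|d d0 dP] := l1 (2 * t) _ W hW; first by lra.
  exists (Order.min (d / 2) (2^-1 - t)); first by rewrite lt_min; apply/andP; lra.
  move=> u u01; rewrite lt_min => /andP[]; rewrite !ltr_norml => tu1 tu2.
  by rewrite ifT ?ifT; [|lra..]; apply: dP; rewrite ?ltr_norml; lra.
- have [|d d0 dP] := l2 (2 * t - 1) _ W hW; first by lra.
  exists (Order.min (d / 2) (t - 2^-1)); first by rewrite lt_min; apply/andP; lra.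
  move=> u u01; rewrite lt_min => /andP[]; rewrite !ltr_norml => tu1 tu2.
  rewrite [u <= _]leNgt (_ : 2^-1 < u); last by lra.
  by apply: dP; rewrite ?ltr_norml; lra.
- move: hW; rewrite divff // => hW.
  have [|d1 d10 dP1] := l1 1 _ W hW; first by lra.
  have [||d2 d20 dP2] := l2 0 _ W; [by lra|by rewrite -g12|].
  exists (Order.min (d1 / 2) (d2 / 2)); first by rewrite lt_min; apply/andP; lra.
  move=> u u01; rewrite lt_min => /andP[]; rewrite !ltr_norml => tu1 tu2.
  case: ifP => u12; first by apply: dP1; rewrite ?ltr_norml; lra.
  rewrite g12 e12; apply: dP2; rewrite ?ltr_norml; first lra.
  by move/negbT: u12; rewrite -ltNge; lra.
Qed.

Lemma lifted_path_trivial (U : set T) e (gamma : R -> T) :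
  (forall q r, U q -> U r -> sigma q r = e q (+) e r) ->
  {within `[0, 1], continuous gamma} -> (forall t, 0 <= t <= 1 -> U (gamma t)) ->
  lifted_path gamma (e \o gamma).
Proof.
move=> He /(within_continuous_epsP (V := R)) cg gU t t01 W hW.
have [|d d0 dP] := cg t _ W hW; first by rewrite /= in_itv.
by exists d => // u u01 tu; split; [apply: dP; rewrite //= in_itv|apply: He; exact: gU].
Qed.

Hypothesis locally_trivial :
  forall p : T, exists2 U : set T, nbhs p U & trivial_on sigma U.

Lemma lifted_path_exists (gamma : R -> T) : {within `[0, 1], continuous gamma} ->
  exists e, lifted_path gamma e.
Proof.
move=> cg; have [||e [d d0 dP]] := sign_lift _ _ locally_trivial cg.
- exact: segment_compact.
- move=> x t; rewrite /= !in_itv /= => x01 t01.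
  by rewrite mulr_ge0 ?mulr_ile1 //; case/andP: x01; case/andP: t01.
exists e => t t01 W hW.
have /(within_continuous_epsP (V := R))/(_ t _ W hW)[|d' d'0 dP'] := cg.
  by rewrite /= in_itv.
exists (Order.min d d') => [|u u01]; first by rewrite lt_min d0.
rewrite lt_min => /andP[tu tu']; split; first by apply: dP'; rewrite //= in_itv.
by apply: dP; rewrite //= in_itv.
Qed.

(** A null-homotopy lifts to the unit square by [sign_lift].  On the three sides
    where it is constant so is its lift, hence the lift of the fourth side, which
    is the loop, has equal end values; by uniqueness so has every lift. *)
Lemma lifted_loop_closed : simply_connected R T ->
  forall gamma e, lifted_path gamma e -> gamma 0 = gamma 1 -> e 0 = e 1.
Proof.
move=> [_ _ null] gamma e le g01.
have [H [cH H0 H1 Hside]] := null gamma (lifted_path_continuous le) g01.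
have cK : compact ((`[0, 1]%classic : set R) `*` (`[0, 1]%classic : set R)).
  by apply: compact_setX; exact: segment_compact.
have [|s [d d0 sP]] := sign_lift cK _ locally_trivial cH.
  move=> [x y] t [/= + + /andP[t0 t1]]; rewrite /= !in_itv /=.
  move=> /andP[x0 x1] /andP[y0 y1].
  have tz (z : R) : 0 <= z -> z <= 1 -> 0 <= t * z <= 1.
    by move=> z0 z1; rewrite mulr_ge0 ?mulr_ile1.
  by apply: conj; exact: tz.
have sigma0 p : sigma p p = false.
  have [U hU [f fP]] := locally_trivial p.
  by rewrite fP ?addbb //; exact: nbhs_singleton.
have K2 (x y : R) : 0 <= x <= 1 -> 0 <= y <= 1 ->
    (`[0, 1]%classic `*` `[0, 1]%classic : set (R * R)) (x, y).
  by move=> x01 y01; split; rewrite /= in_itv.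
have top : s (0, 1) = s (1, 1).
  apply: (locally_constant_ends (e := fun t => s (t, 1))) => t t01.
  exists d => // u u01 tu.
  have : sigma (H (t, 1)) (H (u, 1)) = s (t, 1) (+) s (u, 1).
    apply: sP; [by apply: K2 => //; lra..|].
    by rewrite prod_normE /= subrr normr0 gt_max tu d0.
  by rewrite !H1 // sigma0; case: (s _) (s _) => [] [].
have side (x : R) : x = 0 \/ x = 1 -> s (x, 0) = s (x, 1).
  move=> x01; apply: (locally_constant_ends (e := fun t => s (x, t))) => t t01.
  exists d => // u u01 tu.
  have : sigma (H (x, t)) (H (x, u)) = s (x, t) (+) s (x, u).
    apply: sP; [by apply: K2 => //; case: x01 => ->; lra..|].
    by rewrite prod_normE /= subrr normr0 gt_max tu d0.
  have [Ht0 Ht1] := Hside t t01; have [Hu0 Hu1] := Hside u u01.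
  by case: x01 => ->; rewrite ?Ht0 ?Ht1 ?Hu0 ?Hu1 sigma0; case: (s _) (s _) => [] [].
have ls : lifted_path gamma (fun t => s (t, 0)).
  move=> t t01 W hW.
  have [d1 d10 dP1] := le t t01 W hW.
  exists (Order.min d d1) => [|u u01]; first by rewrite lt_min d0.
  rewrite lt_min => /andP[tu /(dP1 u u01)[Wu _]]; split=> //.
  rewrite -!H0 //; apply: sP; [by apply: K2 => //; lra..|].
  by rewrite prod_normE /= subrr normr0 gt_max tu d0.
have := lifted_path_unique le ls.
rewrite (side 0 (or_introl erefl)) (side 1 (or_intror erefl)) top addbb.
by case: (e 0) (e 1) => [] [].
Qed.

End LiftedPaths.

(** The global potential at p is the total sign of a lift along a chosen path
    from the base point to p.  For q in the given neighborhood of p, the two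
    chosen paths and a path from p to q inside the neighborhood form a loop,
    whose lift is closed. *)
Theorem locally_trivial_sign_cocycle (R : realType) (T : topologicalType)
    (sigma : T -> T -> bool) :
  simply_connected R T ->
  (forall p : T, exists2 U : set T, nbhs p U & trivial_on sigma U /\
     forall q, U q -> exists gamma : R -> T,
       [/\ {within `[0, 1], continuous gamma}, gamma 0 = p, gamma 1 = q
         & forall t, 0 <= t <= 1 -> U (gamma t)]) ->
  exists s : T -> bool, forall p : T, exists2 U : set T, nbhs p U &
    forall q r, U q -> U r -> sigma q r = s q (+) s r.
Proof.
move=> sc loc; have [[p0 _] paths _] := sc.
have triv (p : T) : exists2 U : set T, nbhs p U & trivial_on sigma U.
  by have [U hU [tU _]] := loc p; exists U.
have /choice[c cP] (p : T) : exists c : (R -> T) * (R -> bool),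
    [/\ lifted_path sigma c.1 c.2, c.1 0 = p0 & c.1 1 = p].
  have [gamma [cg g0 g1]] := paths p0 p.
  by have [e le] := lifted_path_exists triv cg; exists (gamma, e).
exists (fun p : T => (c p).2 0 (+) (c p).2 1) => p.
have [U hU [[e eP] joins]] := loc p; exists U => //.
have key (q : T) : U q ->
    (c p).2 0 (+) (c p).2 1 (+) ((c q).2 0 (+) (c q).2 1) = e p (+) e q.
  move=> Uq; have [gamma [cg g0 g1 gU]] := joins q Uq.
  have [lp p_0 p_1] := cP p; have [lq q_0 q_1] := cP q.
  have Up : U p by exact: nbhs_singleton.
  have lg := lifted_path_trivial eP cg gU.
  have lg' := lifted_path_add ((c p).2 1 (+) e p) lg.
  have lr := lifted_path_add ((c p).2 1 (+) e p (+) e q (+) (c q).2 1)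
    (lifted_path_rev lq).
  (* The loop runs to p along its chosen path, from p to q inside U, and
     back along the chosen path of q; the constants added to the last two lifts
     make them match at the junctions. *)
  have l1 := lifted_path_join lp lg'.
  have {}l1 := l1 (etrans p_1 (esym g0)).
  have {}l1 := l1 _.
  have e1 : (c p).2 1 = (e \o gamma) 0 (+) ((c p).2 1 (+) e p).
    by rewrite /= g0; case: ((c p).2 1) (e p) => [] [].
  have l2 := lifted_path_join (l1 e1) lr.
  have n2 : (2^-1 : R) < 1 by lra.
  have le02 : (0 <= 2^-1 :> R) by lra.
  have j1 A (c1 c2 : R -> A) : path_join c1 c2 1 = c2 1.
    by rewrite /path_join leNgt n2 /= mulr1; congr c2; lra.
  have j0 A (c1 c2 : R -> A) : path_join c1 c2 0 = c1 0.
    by rewrite /path_join le02 mulr0.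
  have {}l2 := l2 _ _; rewrite !j1 subr0 g1 q_1 in l2.
  have {}l2 := l2 erefl.
  have e2 : (e \o gamma) 1 (+) ((c p).2 1 (+) e p) =
      (c q).2 1 (+) ((c p).2 1 (+) e p (+) e q (+) (c q).2 1).
    by rewrite /= g1; case: ((c p).2 1) (e p) (e q) ((c q).2 1) => [] [] [] [].
  have := lifted_loop_closed triv sc (l2 e2).
  rewrite !j0 !j1 subrr p_0 q_0 => /(_ erefl).
  by case: ((c p).2 1) (e p) (e q) ((c q).2 1) ((c p).2 0) ((c q).2 0)
    => [] [] [] [] [] [].
move=> q r Uq Ur; rewrite eP //; move: (key q Uq) (key r Ur).
move: ((c q).2 0 (+) (c q).2 1) ((c r).2 0 (+) (c r).2 1).
by move: ((c p).2 0 (+) (c p).2 1) (e p) (e q) (e r) => [] [] [] [] [] [].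
Qed.

(** * Functions of class C^k on an open subset of the plane *)

Section NearEq.
Context {R : numFieldType} {V W : normedModType R}.

(** Differentiability is a local property; this is what allows [C_on] to be
    checked with functions that agree only on the open set. *)
Lemma near_eq_differentiable (F G : V -> W) (x : V) :
  (\near x, F x = G x) -> differentiable F x -> differentiable G x.
Proof.
move=> FG dF; have GFx : G x = F x by rewrite (nbhs_singleton FG).
have FG' : \forall h \near (0 : V), F (h + x) = G (h + x).
  by move: FG; rewrite (near_shift 0) subr0.
have [dFc dFE] := (diff_locallyP _ _).1 dF.
have dGE : G \o shift x = cst (G x) + 'd F x +o_ (0 : V) id.
  apply/eqaddoP => _/posnumP[e].
  have e0 : 0 < e%:num by [].
  have {}dFE := (eqaddoP _ _ _ _).1 dFE e%:num e0.
  apply: filterS2 dFE FG' => h; rewrite !fctE /= /shift /= GFx => dFh <-.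
  exact: dFh.
apply/diff_locallyP; have /= E := diff_unique dFc dGE.
by rewrite E; split.
Qed.

Lemma differentiable_lin (W' : normedModType R) (L : {linear W -> W'})
    (F : V -> W) (x : V) :
  continuous L -> differentiable F x -> differentiable (fun y => L (F y)) x.
Proof.
by move=> cL dF; apply: differentiable_comp => //; exact: linear_differentiable.
Qed.

Lemma derive_lin (W' : normedModType R) (L : {linear W -> W'}) (F : V -> W)
    (x v : V) :
  continuous L -> differentiable F x -> 'D_v (fun y => L (F y)) x = L ('D_v F x).
Proof.
move=> cL dF; rewrite deriveE; last exact: differentiable_lin.
rewrite deriveE // (@diff_comp _ _ _ _ F L) //; last exact: linear_differentiable.
by rewrite /= diff_lin.
Qed.

End NearEq.

Section Smooth.
Context {R : realType}.
Local Notation E := 'rV[R]_2.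

Lemma open_near (U : set E) (P : E -> Prop) x :
  open U -> U x -> (forall y, U y -> P y) -> \near x, P x.
Proof. by move=> oU Ux UP; apply: filterS UP _; apply: open_nbhs_nbhs. Qed.

Lemma derive_eq_on (W : normedModType R) (U : set E) (F G : E -> W) x v :
  open U -> U x -> (forall y, U y -> F y = G y) -> 'D_v F x = 'D_v G x.
Proof. by move=> oU Ux FG; apply: near_eq_derive; exact: open_near FG. Qed.

Lemma differentiable_eq_on (W : normedModType R) (U : set E) (F G : E -> W) x :
  open U -> U x -> (forall y, U y -> F y = G y) ->
  differentiable F x -> differentiable G x.
Proof. by move=> oU Ux FG; apply: near_eq_differentiable; exact: open_near FG. Qed.

Section ConOn.
Variable U : set E.
Hypothesis oU : open U.

Lemma C_on_eq (W : normedModType R) k (F G : E -> W) :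
  (forall y, U y -> F y = G y) -> C_on k U F -> C_on k U G.
Proof.
elim: k F G => [|k IHk] F G FG /= => [cF x Ux|[dF cF]].
  suff : G y @[y --> x] --> G x by [].
  rewrite -FG //; apply: cvg_trans (cF x Ux).
  by apply: (@near_eq_cvg _ _ (nbhs x)); apply: (open_near oU Ux) => y Uy; rewrite FG.
split=> [x Ux|v]; first exact: (differentiable_eq_on oU Ux FG (dF x Ux)).
by apply: IHk (cF v) => y Uy; exact: (derive_eq_on _ oU Uy FG).
Qed.

Lemma C_on_succ (W : normedModType R) k (F : E -> W) : C_on k.+1 U F -> C_on k U F.
Proof.
elim: k F => [|k IHk] F [dF cF]; first by move=> x Ux; apply/differentiable_continuous/dF.
by split=> // v; apply: IHk; exact: cF.
Qed.

Lemma C_on_cst (W : normedModType R) k (a : W) : C_on k U (fun=> a).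
Proof.
elim: k a => [|k IHk] a /=; first by move=> x _; apply: cst_continuous.
split=> [x _|v]; first exact: differentiable_cst.
by apply: C_on_eq (IHk 0) => y _; rewrite derive_cst.
Qed.

Lemma C_on_lin (W W' : normedModType R) k (L : {linear W -> W'}) (F : E -> W) :
  continuous L -> C_on k U F -> C_on k U (fun x => L (F x)).
Proof.
move=> cL; elim: k F => [|k IHk] F /= => [cF x Ux|[dF cF]].
  by apply: continuous_comp; [exact: cF|exact: cL].
split=> [x Ux|v]; first exact/differentiable_lin/dF.
by apply: C_on_eq (IHk _ (cF v)) => y Uy; rewrite derive_lin //; exact: dF.
Qed.

Lemma C_onD (W : normedModType R) k (F G : E -> W) :
  C_on k U F -> C_on k U G -> C_on k U (fun x => F x + G x).
Proof.
elim: k F G => [|k IHk] F G /= => [cF cG x Ux|[dF cF] [dG cG]].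
  by apply: continuousD; [exact: cF|exact: cG].
split=> [x Ux|v]; first by apply: differentiableD; [exact: dF|exact: dG].
apply: C_on_eq (IHk _ _ (cF v) (cG v)) => y Uy.
by rewrite deriveD //; apply: diff_derivable; [exact: dF|exact: dG].
Qed.

Lemma C_on_sum (W : normedModType R) k (I : Type) (r : seq I) (F : I -> E -> W) :
  (forall i, C_on k U (F i)) -> C_on k U (fun x => \sum_(i <- r) F i x).
Proof.
move=> cF; elim: r => [|i r IHr].
  by apply: C_on_eq (C_on_cst k 0) => y _; rewrite big_nil.
by apply: C_on_eq (C_onD (cF i) IHr) => y _; rewrite big_cons.
Qed.

Lemma C_onM k (F G : E -> R^o) :
  C_on k U F -> C_on k U G -> C_on k U (fun x => F x * G x : R^o).
Proof.
elim: k F G => [|k IHk] F G /= => [cF cG x Ux|[dF cF] [dG cG]].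
  by apply: continuousM; [exact: cF|exact: cG].
split=> [x Ux|v]; first by apply: differentiableM; [exact: dF|exact: dG].
have FS : C_on k.+1 U F by []. have GS : C_on k.+1 U G by [].
apply: C_on_eq (C_onD (IHk _ _ (C_on_succ FS) (cG v))
                      (IHk _ _ (C_on_succ GS) (cF v))) => y Uy.
by rewrite [RHS]deriveM //; apply: diff_derivable; [exact: dF|exact: dG].
Qed.

Lemma C_on_prod k (I : Type) (r : seq I) (F : I -> E -> R^o) :
  (forall i, C_on k U (F i)) -> C_on k U (fun x => \prod_(i <- r) F i x : R^o).
Proof.
move=> cF; elim: r => [|i r IHr].
  by apply: C_on_eq (C_on_cst k (1 : R^o)) => y _; rewrite big_nil.
by apply: C_on_eq (C_onM (cF i) IHr) => y _; rewrite big_cons.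
Qed.

Lemma C_onV k (F : E -> R^o) : (forall x, U x -> F x != 0) ->
  C_on k U F -> C_on k U (fun x => (F x)^-1 : R^o).
Proof.
move=> F0; elim: k => [|k IHk] /= => [cF x Ux|[dF cF]].
  by apply: continuousV; [exact: F0|exact: cF].
split=> [x Ux|v]; first by apply: differentiableV; [exact: dF|exact: F0].
have FS : C_on k.+1 U F by [].
have iF := IHk (C_on_succ FS).
apply: C_on_eq (C_onM (C_on_cst k (-1 : R^o)) (C_onM (C_onM iF iF) (cF v))) => y Uy.
rewrite [RHS]deriveV //; [|exact: F0|by apply: diff_derivable; exact: dF].
by rewrite mulN1r -exprVn expr2 -mulNr.
Qed.

(** The derivative of the square root of F is F' / (2 sqrt F), whose regularity
    is one order less than that to be proved. *)
Lemma C_on_sqrt k (F : E -> R^o) : (forall x, U x -> 0 < F x) ->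
  C_on k U F -> C_on k U (fun x => Num.sqrt (F x) : R^o).
Proof.
move=> F0; elim: k => [|k IHk] /= => [cF x Ux|[dF cF]].
  by apply: continuous_comp; [exact: cF|exact: sqrt_continuous].
have dsqrt x : U x -> differentiable (Num.sqrt : R -> R) (F x).
  by move=> Ux; apply/derivable1_diffP; have [] := is_derive1_sqrt (F0 x Ux).
split=> [x Ux|v]; first by apply: differentiable_comp; [exact: dF|exact: dsqrt].
have FS : C_on k.+1 U F by [].
have sF := IHk (C_on_succ FS).
have s2 := C_onM (C_on_cst k (2 : R^o)) sF.
have s20 x : U x -> 2 * Num.sqrt (F x) != 0.
  by move=> Ux; rewrite mulf_neq0 ?pnatr_eq0 // gt_eqF // sqrtr_gt0 F0.
apply: C_on_eq (C_onM (cF v) (C_onV s20 s2)) => y Uy.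
rewrite [RHS]deriveE; last by apply: differentiable_comp; [exact: dF|exact: dsqrt].
rewrite (@diff_comp _ _ _ _ F Num.sqrt) /=; [|exact: dF|exact: dsqrt].
rewrite deriv1E; last by have [] := is_derive1_sqrt (F0 y Uy).
by rewrite derive1E (derive_sqrt (F0 y Uy)) deriveE //; exact: dF.
Qed.

Lemma C_on_locally (W : normedModType R) k (F : E -> W) :
  (forall x, U x -> exists2 V, V x & C_on k V F) -> C_on k U F.
Proof.
elim: k F => [|k IHk] F cF.
  by move=> x Ux; have [V Vx cV] := cF x Ux; exact: cV.
split=> [x Ux|v]; first by have [V Vx [dV _]] := cF x Ux; exact: dV.
by apply: IHk => x Ux; have [V Vx [_ cV]] := cF x Ux; exists V => //; exact: cV.
Qed.

End ConOn.
End Smooth.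

(** * Calculus of matrix-valued functions *)

Section MatrixCalculus.
Context {R : realType}.

Section Pointwise.
Context {V : normedModType R}.

Lemma differentiable_ext (W : normedModType R) (F G : V -> W) x :
  (forall y, G y = F y) -> differentiable F x -> differentiable G x.
Proof. by move=> /funext ->. Qed.

Lemma derive_ext (W : normedModType R) (F G : V -> W) x v :
  (forall y, G y = F y) -> 'D_v G x = 'D_v F x.
Proof. by move=> /funext ->. Qed.

Lemma coord_linear m n (i : 'I_m) (j : 'I_n) :
  linear (fun M : 'M[R]_(m, n) => M i j : R^o).
Proof. by move=> a u v; rewrite !mxE. Qed.

Lemma scalel_linear (W : normedModType R) (w : W) :
  linear (fun a : R^o => a *: w).
Proof. by move=> a u v; rewrite scalerDl scalerA. Qed.

Lemma differentiable_entry m n (M : V -> 'M[R]_(m, n)) i j x :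
  differentiable M x -> differentiable (fun y => M y i j : R^o) x.
Proof.
by move=> dM; apply: (@differentiable_comp _ _ _ _ M (fun N : 'M[R]_(m, n) => N i j));
  last exact: differentiable_coord.
Qed.

Lemma derive_entry m n (M : V -> 'M[R]_(m, n)) i j x v :
  differentiable M x -> 'D_v (fun y => M y i j : R^o) x = ('D_v M x) i j.
Proof. by move=> dM; rewrite derive_mx ?mxE //; exact: diff_derivable. Qed.

Lemma fun_matrix_sum m n (M : V -> 'M[R]_(m, n)) :
  M = \sum_i \sum_j (fun x => M x i j *: delta_mx i j).
Proof.
apply/funext => x; rewrite {1}[M x]matrix_sum_delta fct_sumE.
by apply: eq_bigr => i _; rewrite fct_sumE.
Qed.

Lemma differentiable_matrix m n (M : V -> 'M[R]_(m, n)) x :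
  (forall i j, differentiable (fun y => M y i j : R^o) x) -> differentiable M x.
Proof.
move=> dM; rewrite [M]fun_matrix_sum; apply: differentiable_sum => i.
by apply: differentiable_sum => j; apply: differentiableZl.
Qed.

Lemma differentiable_fsum (W : normedModType R) (I : Type) (r : seq I) (F : I -> V -> W) x :
  (forall i, differentiable (F i) x) ->
  differentiable (fun y => \sum_(i <- r) F i y) x.
Proof.
move=> dF; elim: r => [|i r IHr].
  by apply: differentiable_ext (differentiable_cst 0 x) => y; rewrite big_nil.
by apply: differentiable_ext (differentiableD (dF i) IHr) => y; rewrite big_cons.
Qed.

Lemma derive_fsum (W : normedModType R) (I : Type) (r : seq I) (F : I -> V -> W) x v :
  (forall i, differentiable (F i) x) ->
  'D_v (fun y => \sum_(i <- r) F i y) x = \sum_(i <- r) 'D_v (F i) x.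
Proof.
move=> dF; elim: r => [|i r IHr].
  rewrite (@derive_ext _ (cst 0)) ?derive_cst ?big_nil // => y.
  by rewrite big_nil.
rewrite (@derive_ext _ (F i + (fun y => \sum_(j <- r) F j y))) => [|y]; last first.
  by rewrite big_cons.
rewrite big_cons -IHr deriveD //; apply: diff_derivable => //.
exact: differentiable_fsum.
Qed.

Lemma differentiable_mulmx m n p (M : V -> 'M[R]_(m, n)) (N : V -> 'M[R]_(n, p)) x :
  differentiable M x -> differentiable N x ->
  differentiable (fun y => M y *m N y) x.
Proof.
move=> dM dN; apply: differentiable_matrix => i j.
apply: differentiable_ext => [y|]; first by rewrite mxE.
apply: differentiable_fsum => k; apply: differentiableM; exact: differentiable_entry.
Qed.

Lemma derive_mulmx m n p (M : V -> 'M[R]_(m, n)) (N : V -> 'M[R]_(n, p)) x v :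
  differentiable M x -> differentiable N x ->
  'D_v (fun y => M y *m N y) x = 'D_v M x *m N x + M x *m 'D_v N x.
Proof.
move=> dM dN; have dMN := differentiable_mulmx dM dN.
apply/matrixP => i j; rewrite -derive_entry // !mxE -big_split /=.
rewrite (derive_ext _ _ (fun y => mxE _ _ _ _)) derive_fsum => [|k]; last first.
  by apply: differentiableM; exact: differentiable_entry.
apply: eq_bigr => k _; rewrite [LHS]deriveM; last 2 first.
- by apply: diff_derivable; exact: differentiable_entry.
- by apply: diff_derivable; exact: differentiable_entry.
by rewrite !derive_entry // addrC; congr (_ + _); exact: mulrC.
Qed.

Lemma differentiable_trmx m n (M : V -> 'M[R]_(m, n)) x :
  differentiable M x -> differentiable (fun y => (M y)^T) x.
Proof.
move=> dM; apply: differentiable_matrix => i j.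
by apply: differentiable_ext (differentiable_entry j i dM) => y; rewrite mxE.
Qed.

Lemma derive_trmx m n (M : V -> 'M[R]_(m, n)) x v :
  differentiable M x -> 'D_v (fun y => (M y)^T) x = ('D_v M x)^T.
Proof.
move=> dM; apply/matrixP => i j; rewrite -derive_entry; last exact: differentiable_trmx.
by rewrite mxE -derive_entry //; congr ('D_v _ x); apply/funext => y; rewrite mxE.
Qed.

End Pointwise.

Section ConMatrix.
Variable U : set 'rV[R]_2.

Lemma C_on_ext (W : normedModType R) k (F G : 'rV[R]_2 -> W) :
  (forall y, G y = F y) -> C_on k U F -> C_on k U G.
Proof. by move=> /funext ->. Qed.
Hypothesis oU : open U.
Implicit Type k : nat.

Lemma C_on_entry m n k (M : 'rV[R]_2 -> 'M[R]_(m, n)) i j :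
  C_on k U M -> C_on k U (fun x => M x i j : R^o).
Proof.
pose L : {linear 'M[R]_(m, n) -> R^o} :=
  HB.pack (fun M : 'M[R]_(m, n) => M i j : R^o)
    (GRing.isLinear.Build _ _ _ _ _ (coord_linear i j)).
by apply: (C_on_lin oU (L := L)); exact: coord_continuous.
Qed.

Lemma C_on_matrix m n k (M : 'rV[R]_2 -> 'M[R]_(m, n)) :
  (forall i j, C_on k U (fun x => M x i j : R^o)) -> C_on k U M.
Proof.
move=> cM; rewrite (_ : M = fun x => \sum_i \sum_j M x i j *: delta_mx i j); last first.
  by apply/funext => x; rewrite {1}[M x]matrix_sum_delta.
apply: C_on_sum => // i; apply: C_on_sum => // j.
pose L : {linear R^o -> 'M[R]_(m, n)} :=
  HB.pack (fun a : R^o => a *: (delta_mx i j : 'M[R]_(m, n)))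
    (GRing.isLinear.Build _ _ _ _ _ (scalel_linear (delta_mx i j))).
by apply: (C_on_lin oU (L := L)) => //; exact: scalel_continuous.
Qed.

Lemma C_on_mulmx m n p k (M : 'rV[R]_2 -> 'M[R]_(m, n)) (N : 'rV[R]_2 -> 'M[R]_(n, p)) :
  C_on k U M -> C_on k U N -> C_on k U (fun x => M x *m N x).
Proof.
move=> cM cN; apply: C_on_matrix => i j; apply: C_on_ext => [y|]; first by rewrite mxE.
by apply: C_on_sum => // l; apply: C_onM => //; exact: C_on_entry.
Qed.

Lemma C_on_scale m n k (a : 'rV[R]_2 -> R^o) (M : 'rV[R]_2 -> 'M[R]_(m, n)) :
  C_on k U a -> C_on k U M -> C_on k U (fun x => a x *: M x).
Proof.
move=> ca cM; apply: C_on_matrix => i j; apply: C_on_ext => [y|]; first by rewrite mxE.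
by apply: C_onM => //; exact: C_on_entry.
Qed.

Lemma C_on_trmx m n k (M : 'rV[R]_2 -> 'M[R]_(m, n)) :
  C_on k U M -> C_on k U (fun x => (M x)^T).
Proof.
move=> cM; apply: C_on_matrix => i j.
by apply: C_on_ext (C_on_entry j i cM) => y; rewrite mxE.
Qed.

Lemma C_on_det n k (M : 'rV[R]_2 -> 'M[R]_n) :
  C_on k U M -> C_on k U (fun x => \det (M x) : R^o).
Proof.
move=> cM; apply: C_on_sum => // s.
by apply: C_onM => //; [exact: C_on_cst|apply: C_on_prod => // i; exact: C_on_entry].
Qed.

Lemma C_on_invmx n k (M : 'rV[R]_2 -> 'M[R]_n) :
  (forall x, U x -> M x \in unitmx) ->
  C_on k U M -> C_on k U (fun x => invmx (M x)).
Proof.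
move=> uM cM.
have cadj : C_on k U (fun x => \adj (M x)).
  apply: C_on_matrix => i j; apply: C_on_ext => [y|]; first by rewrite mxE.
  apply: C_onM => //; first exact: C_on_cst.
  apply: C_on_det; apply: C_on_matrix => a b; apply: C_on_ext => [y|]; first by rewrite !mxE.
  exact: C_on_entry.
have cdet : C_on k U (fun x => (\det (M x))^-1 : R^o).
  apply: C_onV => //; last exact: C_on_det.
  by move=> x /uM; rewrite unitmxE unitfE.
apply: C_on_eq (C_on_scale cdet cadj) => // x /uM uMx.
by rewrite /invmx uMx.
Qed.

End ConMatrix.
End MatrixCalculus.

(** * Symmetry of second derivatives and Jacobian matrices *)

Section MixedPartials.
Context {R : realType}.
Local Notation E := 'rV[R]_2.

Lemma is_derive_line (W : normedModType R) (F : E -> W) (y v : E) (t : R) :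
  differentiable F (y + t *: v) ->
  is_derive t 1 (fun s : R => F (y + s *: v)) ('D_v F (y + t *: v)).
Proof.
move=> dF.
pose l : R -> E := cst y + ( *:%R ^~ v).
have dl : differentiable l t by exact: differentiableD.
have ds : is_diff t ( *:%R ^~ v : R -> E) ( *:%R ^~ v) := is_diff_scalel t v.
have dlE : 'd l t 1 = v.
  rewrite -deriveE // [LHS]deriveD; last 2 first.
  - exact: derivable_cst.
  - by apply: diff_derivable; exact: (@ex_diff _ _ _ _ _ _ _ ds).
  rewrite derive_cst add0r deriveE; last exact: (@ex_diff _ _ _ _ _ _ _ ds).
  by rewrite (@diff_val _ _ _ _ _ _ _ ds) scale1r.
apply: DeriveDef; first exact/diff_derivable/(differentiable_comp dl dF).
rewrite deriveE; last exact: (differentiable_comp dl dF).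
by rewrite (@diff_comp _ _ _ _ l F) //= dlE deriveE.
Qed.

(** Two applications of the mean value theorem: the second difference of F over
    the parallelogram with sides h u and h v is h^2 D_v D_u F at an intermediate
    point. *)
Lemma second_difference_derive (U : set E) (F : E -> R^o) (x u v : E) (e : R) :
  open U -> C_on 2 U F -> U x -> 0 < e ->
  exists2 d : R, 0 < d & forall h, 0 < h < d ->
    `|(F (x + h *: u + h *: v) - F (x + h *: u)) - (F (x + h *: v) - F x)
      - h ^+ 2 * 'D_v (fun y => 'D_u F y) x| <= e * h ^+ 2.
Proof.
move=> oU [dF /(_ u)[dDF /(_ v) cDDF]] Ux e0.
have /nbhs_ballP[r1 /= r10 r1U] : nbhs x U by exact: open_nbhs_nbhs.
have /cvgrPdist_le /(_ e e0) /nbhs_ballP[r2 /= r20 r2P] := cDDF x Ux.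
pose r := Order.min r1 r2; have r0 : 0 < r by rewrite lt_min r10.
pose M := `|u| + `|v| + 1; have M0 : 0 < M by rewrite ltr_wpDl // addr_ge0.
have near_x h (s t : R) : 0 < h < r / M -> 0 <= s <= h -> 0 <= t <= h ->
    ball x r (x + s *: u + t *: v).
  move=> /andP[h0 hr] /andP[s0 sh] /andP[t0 th].
  rewrite -ball_normE /= -addrA opprD addNKr normrN.
  rewrite (le_lt_trans (ler_normD _ _)) // !normrZ !ger0_norm //.
  move: hr; rewrite ltr_pdivlMr // => /(le_lt_trans _); apply.
  rewrite /M !mulrDr mulr1 ler_wpDr ?(ltW h0) //.
  by rewrite lerD // ler_wpM2r.
have inU h (s t : R) : 0 < h < r / M -> 0 <= s <= h -> 0 <= t <= h ->
    U (x + s *: u + t *: v).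
  move=> hr sh th; apply: r1U; apply: (le_ball _ (near_x h s t hr sh th)).
  by rewrite ge_min lexx.
exists (r / M); first by rewrite divr_gt0.
move=> h hr; have /andP[h0 _] := hr.
have h00 : 0 <= (0 : R) <= h by apply/andP; split; [exact: lexx|exact: ltW].
have hh : 0 <= h <= h by apply/andP; split; [exact: ltW|exact: lexx].
have der1 s : 0 <= s <= h ->
    is_derive s 1 (fun s => F (x + h *: v + s *: u) - F (x + s *: u) : R^o)
      ('D_u F (x + h *: v + s *: u) - 'D_u F (x + s *: u)).
  move=> sh; apply: is_deriveB; apply: is_derive_line; apply: dF.
    by rewrite addrAC; exact: (inU h).
  by rewrite -[_ + _]addr0 -(scale0r v); exact: (inU h).
have [||s sh E1] := @MVT_segment R (fun s => F (x + h *: v + s *: u) - F (x + s *: u))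
  (fun s => 'D_u F (x + h *: v + s *: u) - 'D_u F (x + s *: u)) 0 h (ltW h0).
- by move=> s; rewrite in_itv /= => /andP[/ltW s0 /ltW sh]; apply: der1; rewrite s0.
- apply: continuous_in_subspaceT => s; rewrite inE /= in_itv /= => sh.
  by apply: differentiable_continuous; apply/derivable1_diffP; have [] := der1 s sh.
move: sh; rewrite in_itv /= => sh.
have der2 t : 0 <= t <= h ->
    is_derive t 1 (fun t => 'D_u F (x + s *: u + t *: v) : R^o)
      ('D_v (fun y => 'D_u F y) (x + s *: u + t *: v)).
  by move=> th; apply: is_derive_line; apply: dDF; exact: (inU h).
have [||t th E2] := @MVT_segment R (fun t => 'D_u F (x + s *: u + t *: v))
  (fun t => 'D_v (fun y => 'D_u F y) (x + s *: u + t *: v)) 0 h (ltW h0).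
- by move=> t; rewrite in_itv /= => /andP[/ltW t0 /ltW th]; apply: der2; rewrite t0.
- apply: continuous_in_subspaceT => t; rewrite inE /= in_itv /= => th.
  by apply: differentiable_continuous; apply/derivable1_diffP; have [] := der2 t th.
move: th; rewrite in_itv /= => th.
move: E1 E2; rewrite !scale0r !addr0 !subr0 => E1 E2.
have -> : F (x + h *: u + h *: v) - F (x + h *: u) - (F (x + h *: v) - F x) =
    h ^+ 2 * 'D_v (fun y => 'D_u F y) (x + s *: u + t *: v).
  rewrite [x + h *: u + _]addrAC E1 [x + h *: v + _]addrAC E2.
  by rewrite expr2 -mulrA mulrC.
rewrite -mulrBr normrM ger0_norm ?sqr_ge0 // mulrC ler_wpM2r ?sqr_ge0 //.
rewrite distrC; apply: r2P; apply: (le_ball _ (near_x h s t hr sh th)).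
by rewrite ge_min lexx orbT.
Qed.

(** The second difference is symmetric in u and v. *)
Lemma derive_comm (U : set E) (F : E -> R^o) (x u v : E) :
  open U -> C_on 2 U F -> U x ->
  'D_u (fun y => 'D_v F y) x = 'D_v (fun y => 'D_u F y) x.
Proof.
move=> oU cF Ux; apply/eqP; rewrite -subr_eq0 -normr_le0; apply/ler_addgt0Pr => e e0.
have e20 : 0 < e / 2 by rewrite divr_gt0.
have [d1 d10 d1P] := second_difference_derive u v oU cF Ux e20.
have [d2 d20 d2P] := second_difference_derive v u oU cF Ux e20.
pose h := Order.min d1 d2 / 2.
have m0 : 0 < Order.min d1 d2 by rewrite lt_min d10.
have h0 : 0 < h by rewrite divr_gt0.
have hm : h < Order.min d1 d2 by rewrite ltr_pdivrMr // ltr_pMr // ltr1n.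
have /d1P H1 : 0 < h < d1 by rewrite h0 (lt_le_trans hm) // ge_min lexx.
have /d2P H2 : 0 < h < d2 by rewrite h0 (lt_le_trans hm) // ge_min lexx orbT.
have h20 : 0 < h ^+ 2 by rewrite exprn_gt0.
rewrite add0r -(ler_pM2l h20) -{1}(gtr0_norm h20) -normrM mulrBr.
move: H1 H2; rewrite [x + h *: v + h *: u]addrAC.
move: ('D_u _ x) ('D_v _ x) => a b; rewrite !ler_norml.
by move=> /andP[H1 H2] /andP[H3 H4]; apply/andP; split; lra.
Qed.

Lemma C_on_derive_comm_mx m n (U : set E) (F : E -> 'M[R]_(m, n)) (x u v : E) :
  open U -> C_on 2 U F -> U x ->
  'D_u (fun y => 'D_v F y) x = 'D_v (fun y => 'D_u F y) x.
Proof.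
move=> oU cF Ux; have [dF cDF] := cF.
have dDF w y : U y -> differentiable (fun y => 'D_w F y) y.
  by move=> Uy; have [+ _] := cDF w; exact.
apply/matrixP => i j.
apply: (etrans (esym (derive_entry i j u (dDF v x Ux)))).
apply: (etrans _ (derive_entry i j v (dDF u x Ux))).
have E w y : U y -> ('D_w F y) i j = 'D_w (fun z => F z i j : R^o) y.
  by move=> Uy; rewrite derive_entry //; exact: dF.
rewrite (derive_eq_on u oU Ux (E v)) (derive_eq_on v oU Ux (E u)).
by apply: (derive_comm _ _ oU _ Ux); exact: C_on_entry.
Qed.

End MixedPartials.

Section Jacobian.
Context {R : realType}.
Variable U : set 'rV[R]_2.
Hypothesis oU : open U.

Lemma row_jacobian n (F : 'rV[R]_2 -> 'rV[R]_n) x k : differentiable F x ->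
  row k ('J F x) = 'D_(basisv k) F x.
Proof. by move=> dF; rewrite rowE deriveEjacobian. Qed.

Lemma jacobian_entry n (F : 'rV[R]_2 -> 'rV[R]_n) x k c : differentiable F x ->
  'J F x k c = 'D_(basisv k) F x 0 c.
Proof. by move=> dF; rewrite -row_jacobian // [RHS]mxE. Qed.

Lemma C_on_jacobian n k (F : 'rV[R]_2 -> 'rV[R]_n) : C_on k.+1 U F ->
  C_on k U (fun x => 'J F x).
Proof.
move=> [dF cF]; apply: C_on_matrix => // i j.
apply: (@C_on_eq _ _ oU _ _ (fun x => 'D_(basisv i) F x 0 j : R^o)) => [y Uy|].
  by rewrite jacobian_entry //; exact: dF.
exact: (C_on_entry oU 0 j (cF (basisv i))).
Qed.

Lemma row_derive_jacobian n (F : 'rV[R]_2 -> 'rV[R]_n) x v k : C_on 2 U F -> U x ->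
  row k ('D_v (fun y => 'J F y) x) = 'D_v (fun y => 'D_(basisv k) F y) x.
Proof.
move=> cF Ux; have [dF cDF] := cF; have [dJ _] := C_on_jacobian cF.
have dDF w y : U y -> differentiable (fun y => 'D_w F y) y.
  by move=> Uy; have [+ _] := cDF w; exact.
apply/rowP => c; rewrite mxE.
apply: (etrans (esym (derive_entry k c v (dJ x Ux)))).
apply: (etrans _ (derive_entry 0 c v (dDF (basisv k) x Ux))).
by apply: (derive_eq_on _ oU Ux) => y Uy; rewrite jacobian_entry //; exact: dF.
Qed.

(** Both sides are the mixed second derivative of F. *)
Lemma derive_jacobian_sym n (F : 'rV[R]_2 -> 'rV[R]_n) x k l : C_on 2 U F -> U x ->
  row l ('D_(basisv k) (fun y => 'J F y) x) = row k ('D_(basisv l) (fun y => 'J F y) x).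
Proof.
move=> cF Ux; apply: (etrans (row_derive_jacobian _ l cF Ux)).
apply: (etrans _ (esym (row_derive_jacobian _ k cF Ux))).
exact: (C_on_derive_comm_mx _ _ oU cF Ux).
Qed.

End Jacobian.

(** * The Gauss and Ricci equations *)

Section Gram.
Context {R : realType}.

Lemma row_entry m n (M : 'M[R]_(m, n)) i j : row i M 0 j = M i j.
Proof. by rewrite mxE. Qed.

Lemma trmx_entry m n (M : 'M[R]_(m, n)) i j : M^T i j = M j i.
Proof. by rewrite mxE. Qed.

Lemma addmx_entry m n (M N : 'M[R]_(m, n)) i j : (M + N) i j = M i j + N i j.
Proof. by rewrite mxE. Qed.

Lemma mulmx_entry m n p (M : 'M[R]_(m, n)) (N : 'M[R]_(n, p)) i j :
  (M *m N) i j = \sum_k M i k * N k j.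
Proof. by rewrite mxE. Qed.

Lemma dotE n (u v : 'rV[R]_n) : dot u v = \sum_i u 0 i * v 0 i.
Proof. by rewrite /dot mxE; apply: eq_bigr => i _; rewrite mxE. Qed.

Lemma dotC n (u v : 'rV[R]_n) : dot u v = dot v u.
Proof. by rewrite !dotE; apply: eq_bigr => i _; rewrite mulrC. Qed.

Lemma dot_ge0 n (u : 'rV[R]_n) : 0 <= dot u u.
Proof. by rewrite dotE sumr_ge0 // => i _; rewrite -expr2 sqr_ge0. Qed.

Lemma dot_eq0 n (u : 'rV[R]_n) : dot u u = 0 -> u = 0.
Proof.
rewrite dotE => /eqP; rewrite psumr_eq0; last by move=> i _; rewrite -expr2 sqr_ge0.
move=> /allP u0; apply/rowP => i; rewrite mxE; apply/eqP.
by have := u0 i (mem_index_enum _); rewrite -expr2 sqrf_eq0.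
Qed.

Lemma gram_sym m n (A : 'M[R]_(m, n)) : (A *m A^T)^T = A *m A^T.
Proof. by rewrite trmx_mul trmxK. Qed.

Lemma gram_unit m n (A : 'M[R]_(m, n)) : row_free A -> A *m A^T \in unitmx.
Proof.
move=> fA; rewrite -row_free_unit -kermx_eq0; apply/rowV0P => v /sub_kermxP.
rewrite mulmxA => vA; have : dot (v *m A) (v *m A) = 0.
  by rewrite /dot trmx_mul mulmxA vA mul0mx mxE.
by move/dot_eq0/eqP; rewrite mulmx_free_eq0 // => /eqP.
Qed.

Lemma curvature_entry n (M N X Y : 'M[R]_n) k l :
  M k l - N k l + \sum_m (Y k m * X m l - X k m * Y m l) = 0 ->
  (M - N + (Y *m X - X *m Y)) k l = (0 : 'M[R]_n) k l.
Proof. by rewrite sumrB => E; rewrite !mxE. Qed.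

(** Read I as the metric, Dk, Dl as derivatives of A, Gk, Gl as connection
    matrices, DG as a derivative of Gl and DD as a second derivative of A: the
    hypothesis is the derivative of Gl I = Dl A^T. *)
Lemma gauss_algebra n (DG Gl Gk I : 'M[R]_2) (A Dk Dl DD : 'M[R]_(2, n)) :
  DG *m I + Gl *m (Dk *m A^T + A *m Dk^T) = DD *m A^T + Dl *m Dk^T ->
  Gk *m I = Dk *m A^T -> I^T = I ->
  DG *m I + Gl *m Gk *m I = DD *m A^T + (Dl *m Dk^T - Gl *m I *m Gk^T).
Proof.
move=> E EG symI; rewrite addrA -E -mulmxA EG.
have -> : Gl *m I *m Gk^T = Gl *m (A *m Dk^T).
  by rewrite -mulmxA -{1}symI -trmx_mul EG trmx_mul trmxK.
by rewrite mulmxDr addrA addrK.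
Qed.

Lemma curvature_cancel n (M N X Y I K S T : 'M[R]_n) :
  M - N + (Y *m X - X *m Y) = 0 ->
  M *m I + Y *m X *m I = K + S -> N *m I + X *m Y *m I = K + T -> S = T.
Proof.
move=> curv0 E1 E2; apply: (addrI K); rewrite -E1 -E2 -!mulmxDl.
by congr (_ *m _); apply/eqP; rewrite -subr_eq0 opprD addrACA curv0.
Qed.

(** Acts on row vectors, hence on the right. *)
Definition normal_projector n (A : 'M[R]_(2, n)) : 'M[R]_n :=
  1%:M - A^T *m invmx (A *m A^T) *m A.

Section Projector.
Context {n : nat} (A : 'M[R]_(2, n)).
Hypothesis fA : row_free A.
Local Notation P := (normal_projector A).

Lemma mul_normal_projector : A *m P = 0.
Proof. by rewrite mulmxBr mulmx1 !mulmxA mulmxV ?gram_unit // mul1mx subrr. Qed.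

Lemma normal_projector_sym : P^T = P.
Proof.
by rewrite /P linearB /= trmx1 !trmx_mul trmxK trmx_inv gram_sym mulmxA.
Qed.

Lemma normal_projector_mul : P *m A^T = 0.
Proof. by rewrite -normal_projector_sym -trmx_mul mul_normal_projector trmx0. Qed.

Lemma normal_projector_idem : P *m P = P.
Proof.
rewrite {1}/normal_projector mulmxBl mul1mx -!mulmxA mul_normal_projector.
by rewrite !mulmx0 subr0.
Qed.

Lemma normal_projector_id (w : 'rV[R]_n) : w *m A^T = 0 -> w *m P = w.
Proof. by move=> wA; rewrite mulmxBr mulmx1 !mulmxA wA !mul0mx subr0. Qed.

(** The hypotheses are the derivatives of A P = 0, P A^T = 0 and P P = P.  The
    last one gives P Pv P = 0, so only the tangential part A^T I^-1 A of the
    identity survives between Pv and Pu. *)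
Lemma ricci_algebra (Du Dv : 'M[R]_(2, n)) (Pu Pv : 'M[R]_n) :
  Du *m P + A *m Pu = 0 -> Pv *m A^T + P *m Dv^T = 0 ->
  Pv *m P + P *m Pv = Pv ->
  P *m Pv *m Pu *m P = (Dv *m P)^T *m invmx (A *m A^T) *m (Du *m P).
Proof.
move=> Eu Ev EP.
have idP := normal_projector_idem.
have PPP : P *m Pv *m P = 0.
  have := congr1 (mulmx P) EP; rewrite mulmxDr !mulmxA idP => /eqP.
  by rewrite -subr_eq0 addrK => /eqP.
have one : 1%:M = P + A^T *m invmx (A *m A^T) *m A.
  by rewrite /normal_projector subrK.
have EA : A *m Pu *m P = - (Du *m P).
  have := congr1 (mulmx^~ P) Eu; rewrite mul0mx mulmxDl -mulmxA idP => /eqP.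
  by rewrite addrC addr_eq0 => /eqP.
have EAT : P *m Pv *m A^T = - (Dv *m P)^T.
  have := congr1 (mulmx P) Ev; rewrite mulmx0 mulmxDr !mulmxA idP => /eqP.
  by rewrite addr_eq0 trmx_mul normal_projector_sym => /eqP.
rewrite -[P *m Pv]mulmx1 one (mulmxDr (P *m Pv)) PPP add0r !mulmxA EAT.
by rewrite -!mulmxA [A *m (Pu *m P)]mulmxA EA mulNmx !mulmxN opprK.
Qed.

End Projector.

(** For the normal field w P, the second covariant derivatives are
    w (K P + Pv Pu) P and w (K P + Pu Pv) P, where K is the mixed second
    derivative of P; K cancels from the curvature. *)
Lemma ricci_commutator n (P K Pu Pv : 'M[R]_n) :
  (forall w : 'rV[R]_n,
     w *m (K *m P + Pv *m Pu) *m P - w *m (K *m P + Pu *m Pv) *m P = 0) ->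
  P *m Pv *m Pu *m P = P *m Pu *m Pv *m P.
Proof.
move=> E; apply/row_matrixP => i.
have := E (row i P); rewrite !mulmxDr !mulmxDl opprD addrACA subrr add0r !row_mul.
by move/eqP; rewrite subr_eq0 => /eqP; rewrite !mulmxA.
Qed.
End Gram.

Section StructureEquations.
Context {R : realType}.
Variables (U : set 'rV[R]_2) (F : 'rV[R]_2 -> 'rV[R]_4).
Hypothesis oU : open U.
Hypothesis sF : smooth_on U F.
Hypothesis fF : forall x, U x -> row_free ('J F x).

Local Notation A := (fun x => 'J F x).
Local Notation I := (first_fundamental_form F).
Local Notation P := (fun x => normal_projector ('J F x)).
Local Notation DA k x := ('D_(basisv k) (fun y => 'J F y) x).

(** Row l of [second_form_rows k x] is alpha(d_k, d_l). *)
Definition second_form_rows (k : 'I_2) (x : 'rV[R]_2) : 'M[R]_(2, 4) :=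
  DA k x *m P x.
Local Notation L := second_form_rows.

Lemma normal_projE x w : normal_proj F x w = w *m P x.
Proof. by rewrite /normal_proj /normal_projector mulmxBr mulmx1 !mulmxA. Qed.

Lemma first_fundamental_form_unit x : U x -> I x \in unitmx.
Proof. by move=> Ux; exact/gram_unit/fF. Qed.

Lemma jacobian_smooth : smooth_on U A.
Proof. by move=> k; exact: C_on_jacobian. Qed.

Lemma first_fundamental_form_smooth : smooth_on U I.
Proof.
move=> k; apply: (C_on_mulmx oU (M := A) (N := fun x => (A x)^T)).
  exact: jacobian_smooth.
by apply: (C_on_trmx oU); exact: jacobian_smooth.
Qed.

Lemma invmx_first_fundamental_form_smooth : smooth_on U (fun x => invmx (I x)).
Proof.
move=> k; apply: C_on_invmx => //; first exact: first_fundamental_form_unit.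
exact: first_fundamental_form_smooth.
Qed.

Lemma normal_projector_smooth : smooth_on U P.
Proof.
move=> k; apply: C_onD => //; first exact: C_on_cst.
apply: (@C_on_ext _ _ _ _ (fun x => ((-1 : R^o) *: (A x)^T) *m invmx (I x) *m A x)).
  by move=> y; rewrite scaleN1r !mulNmx.
apply: C_on_mulmx => //; last exact: jacobian_smooth.
apply: C_on_mulmx => //; last exact: invmx_first_fundamental_form_smooth.
apply: C_on_scale => //; first exact: C_on_cst.
by apply: C_on_trmx => //; exact: jacobian_smooth.
Qed.

Lemma smooth_differentiable (W : normedModType R) (G : 'rV[R]_2 -> W) x :
  smooth_on U G -> U x -> differentiable G x.
Proof. by move=> sG; have [dG _] := sG 1%N; exact: dG. Qed.

Lemma smooth_derive (W : normedModType R) (G : 'rV[R]_2 -> W) v :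
  smooth_on U G -> smooth_on U (fun x => 'D_v G x).
Proof. by move=> sG k; have [_ dG] := sG k.+1; exact: dG. Qed.

Lemma second_form_rows_smooth k : smooth_on U (L k).
Proof.
move=> n; apply: C_on_mulmx => //; last exact: normal_projector_smooth.
exact: (smooth_derive _ jacobian_smooth).
Qed.

(** Entry (j, m) of [connection_matrix i] is the Christoffel symbol with upper
    index m and lower indices i, j: D_i A = Gam_i A + L_i, where L_i is
    [second_form_rows i]. *)
Definition connection_matrix (k : 'I_2) (x : 'rV[R]_2) : 'M[R]_2 :=
  DA k x *m (A x)^T *m invmx (I x).
Local Notation Gam := connection_matrix.

Lemma connection_matrix_smooth k : smooth_on U (Gam k).
Proof.
move=> n; apply: C_on_mulmx => //; last exact: invmx_first_fundamental_form_smooth.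
apply: C_on_mulmx => //; last by apply: C_on_trmx => //; exact: jacobian_smooth.
exact: (smooth_derive _ jacobian_smooth).
Qed.

Lemma derive_jacobian_swap k l x : U x -> row l (DA k x) = row k (DA l x).
Proof. by move=> Ux; exact: (derive_jacobian_sym oU k l (sF 2%N) Ux). Qed.

Lemma derive_first_fundamental_form v x : U x -> 'D_v I x =
  'D_v A x *m (A x)^T + A x *m ('D_v A x)^T.
Proof.
move=> Ux; have dA := smooth_differentiable jacobian_smooth Ux.
by rewrite derive_mulmx ?derive_trmx //; exact: differentiable_trmx.
Qed.

Lemma christoffelE k i j x : U x -> christoffel I k i j x = Gam i x j k.
Proof.
move=> Ux; set G := fun i => DA i x *m (A x)^T.
have Gsym a b l : G a b l = G b a l.
  have E : row b (G a) = row a (G b) by rewrite !row_mul derive_jacobian_swap.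
  exact: etrans (esym (row_entry (G a) b l))
    (etrans (congr1 (fun r : 'rV_2 => r 0 l) E) (row_entry (G b) a l)).
have dI a b l : dmetric I a b l x = G a b l + G a l b.
  apply: etrans
    (derive_entry b l _ (smooth_differentiable first_fundamental_form_smooth Ux)) _.
  rewrite (derive_first_fundamental_form _ Ux) addmx_entry; congr (_ + _).
  have -> : A x *m (DA a x)^T = (G a)^T by rewrite trmx_mul trmxK.
  exact: trmx_entry.
have Isym l : invmx (I x) k l = invmx (I x) l k.
  have : (invmx (I x))^T = invmx (I x) by rewrite trmx_inv gram_sym.
  by move=> /(congr1 (fun M : 'M[R]_2 => M k l)); rewrite trmx_entry.
have -> : connection_matrix i x = G i *m invmx (I x) by [].
clearbody G; rewrite mulmx_entry /christoffel mulr_sumr.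
apply: eq_bigr => l _; rewrite !dI Isym (Gsym i l j) (Gsym j i l) (Gsym j l i).
move: (G i j l) (G l i j) (G l j i) (invmx _ l k) => p q r s.
by field.
Qed.

(** The curvature in matrix form is D_0 Gam_1 - D_1 Gam_0 + [Gam_1, Gam_0].
    Differentiating Gam_l I = D_l A A^T and subtracting, the second derivatives
    of A cancel and L_1 L_0^T - L_0 L_1^T remains. *)
Theorem gauss_equation x : U x ->
  (forall l a b c, riemann I l a b c x = 0) ->
  L 0 x *m (L 1 x)^T = L 1 x *m (L 0 x)^T.
Proof.
move=> Ux flat; set i : 'I_2 := 0; set j : 'I_2 := 1.
have curv0 : 'D_(basisv i) (Gam j) x - 'D_(basisv j) (Gam i) x
    + (Gam j x *m Gam i x - Gam i x *m Gam j x) = 0.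
  apply/matrixP => k l.
  have dG a := smooth_differentiable (connection_matrix_smooth a) Ux.
  have E1 a b : 'D_(basisv a) (christoffel I l b k) x = ('D_(basisv a) (Gam b) x) k l.
    apply: etrans (derive_entry k l _ (dG b)).
    by apply: (derive_eq_on _ oU Ux) => y Uy; exact: christoffelE.
  have E2 a b : christoffel I a b k x = Gam b x k a by exact: christoffelE.
  have E3 a b : christoffel I l a b x = Gam a x b l by exact: christoffelE.
  have := flat l i j k; rewrite /riemann !E1.
  under eq_bigr do rewrite !E2 !E3.
  exact: curvature_entry.
have GamI k y : U y -> Gam k y *m I y = DA k y *m (A y)^T.
  by move=> Uy; rewrite -mulmxA mulVmx ?mulmx1 // first_fundamental_form_unit.
have dA := smooth_differentiable jacobian_smooth Ux.
have dDA k : differentiable (fun y => DA k y) x.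
  exact: smooth_differentiable (smooth_derive _ jacobian_smooth) Ux.
have dI := smooth_differentiable first_fundamental_form_smooth Ux.
have LL k l : L k x *m (L l x)^T = DA k x *m (DA l x)^T - Gam k x *m I x *m (Gam l x)^T.
  rewrite /L trmx_mul normal_projector_sym // mulmxA -[_ *m P x *m P x]mulmxA.
  rewrite normal_projector_idem //; last exact: fF.
  rewrite /normal_projector mulmxBr mulmx1 mulmxBl; congr (_ - _).
  rewrite GamI // /Gam !trmx_mul trmx_inv gram_sym trmxK !mulmxA.
  by [].
have key k l : 'D_(basisv k) (Gam l) x *m I x + Gam l x *m Gam k x *m I x =
    'D_(basisv k) (fun y => DA l y) x *m (A x)^T + L l x *m (L k x)^T.
  have dG := smooth_differentiable (connection_matrix_smooth l) Ux.
  have : 'D_(basisv k) (fun y => Gam l y *m I y) x =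
         'D_(basisv k) (fun y => DA l y *m (A y)^T) x.
    by apply: (derive_eq_on _ oU Ux) => y Uy; exact: GamI.
  rewrite (derive_mulmx _ dG dI) (derive_mulmx _ (dDA l) (differentiable_trmx dA)).
  rewrite (derive_trmx _ dA) (derive_first_fundamental_form _ Ux) LL => E.
  exact: (gauss_algebra E (GamI k x Ux) (gram_sym _)).
have comm := C_on_derive_comm_mx (basisv i) (basisv j) oU (jacobian_smooth 2%N) Ux.
have keyji := key j i; rewrite -comm in keyji.
exact: esym (curvature_cancel curv0 (key i j) keyji).
Qed.

(** It suffices to know the normal curvature on the projections of constant
    vectors, since these span every normal space. *)
Theorem ricci_equation x : U x ->
  (forall w u v, normal_curvature F u v (fun y => normal_proj F y w) x = 0) ->
  (L 0 x)^T *m invmx (I x) *m L 1 x = (L 1 x)^T *m invmx (I x) *m L 0 x.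
Proof.
move=> Ux flat.
have dP y (Uy : U y) := smooth_differentiable normal_projector_smooth Uy.
have sDP v := smooth_derive v normal_projector_smooth.
have dDP v y (Uy : U y) := smooth_differentiable (sDP v) Uy.
have connE w v y : U y ->
    normal_connection F v (fun y => normal_proj F y w) y = w *m 'D_v P y *m P y.
  move=> Uy; rewrite /normal_connection normal_projE; congr (_ *m _).
  rewrite (derive_ext _ _ (fun z => normal_projE z w)).
  rewrite (derive_mulmx _ (differentiable_cst w y) (dP y Uy)).
  by rewrite derive_cst mul0mx add0r.
have conn2E w u v : normal_connection F u (normal_connection F v
    (fun y => normal_proj F y w)) x =
    w *m ('D_u (fun y => 'D_v P y) x *m P x + 'D_v P x *m 'D_u P x) *m P x.
  rewrite {1}/normal_connection normal_projE; congr (_ *m _).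
  rewrite (derive_eq_on _ oU Ux (fun y Uy => connE w v y Uy)).
  have dw := differentiable_mulmx (differentiable_cst w x) (dDP v x Ux).
  apply: etrans (derive_mulmx _ dw (dP x Ux)) _.
  rewrite (derive_mulmx _ (differentiable_cst w x) (dDP v x Ux)).
  by rewrite derive_cst mul0mx add0r [RHS]mulmxDr !mulmxA.
pose e0 : 'rV[R]_2 := basisv 0; pose e1 : 'rV[R]_2 := basisv 1.
have comm := C_on_derive_comm_mx e1 e0 oU (normal_projector_smooth 2%N) Ux.
have curv : P x *m 'D_e0 P x *m 'D_e1 P x *m P x =
    P x *m 'D_e1 P x *m 'D_e0 P x *m P x.
  apply: (ricci_commutator (K := 'D_e1 (fun y => 'D_e0 P y) x)) => w.
  have C1 := conn2E w e1 e0; have C2 := conn2E w e0 e1; rewrite -comm in C2.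
  exact: (etrans (esym (congr2 (fun a b => a - b) C1 C2)) (flat w e1 e0)).
have dA := smooth_differentiable jacobian_smooth Ux.
have EL v : 'D_v A x *m P x + A x *m 'D_v P x = 0.
  rewrite -(derive_mulmx _ dA (dP x Ux)) -(derive_cst (0 : 'M[R]_(2, 4)) x v).
  by apply: (derive_eq_on _ oU Ux) => y Uy; apply: mul_normal_projector; exact: fF.
have ER v : 'D_v P x *m (A x)^T + P x *m ('D_v A x)^T = 0.
  rewrite -(derive_trmx _ dA) -(derive_mulmx _ (dP x Ux) (differentiable_trmx dA)).
  rewrite -(derive_cst (0 : 'M[R]_(4, 2)) x v).
  by apply: (derive_eq_on _ oU Ux) => y Uy; apply: normal_projector_mul; exact: fF.
have EP v : 'D_v P x *m P x + P x *m 'D_v P x = 'D_v P x.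
  rewrite -(derive_mulmx _ (dP x Ux) (dP x Ux)).
  by apply: (derive_eq_on _ oU Ux) => y Uy; apply: normal_projector_idem; exact: fF.
have R01 := ricci_algebra (fF Ux) (EL e1) (ER e0) (EP e0).
have R10 := ricci_algebra (fF Ux) (EL e0) (ER e1) (EP e1).
exact: (etrans (esym R01) (etrans curv R10)).
Qed.

End StructureEquations.

(** * The normal area form *)

Section TwoByTwo.
Context {R : comUnitRingType}.
Implicit Types p q r s : R.

Lemma ord2_ind (P : 'I_2 -> Prop) : P 0 -> P 1 -> forall i, P i.
Proof.
move=> P0 P1 [[|[|//]] lt_i2]; [move: P0|move: P1];
  by congr (P _); apply: val_inj.
Qed.

Definition mx22 p q r s : 'M[R]_2 :=
  \matrix_(i, j) if i == 0 then (if j == 0 then p else q)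
                 else (if j == 0 then r else s).

Lemma mx22E (M : 'M[R]_2) : M = mx22 (M 0 0) (M 0 1) (M 1 0) (M 1 1).
Proof. by apply/matrixP; apply: ord2_ind; apply: ord2_ind; rewrite mxE. Qed.

Lemma mx22_mul p q r s p' q' r' s' :
  mx22 p q r s *m mx22 p' q' r' s' =
  mx22 (p * p' + q * r') (p * q' + q * s') (r * p' + s * r') (r * q' + s * s').
Proof.
by apply/matrixP; apply: ord2_ind; apply: ord2_ind;
  rewrite !mxE !big_ord_recl big_ord0 !mxE /= addr0.
Qed.

Lemma mx22_tr p q r s : (mx22 p q r s)^T = mx22 p r q s.
Proof. by apply/matrixP; apply: ord2_ind; apply: ord2_ind; rewrite !mxE. Qed.

Lemma mx22_add p q r s p' q' r' s' :
  mx22 p q r s + mx22 p' q' r' s' = mx22 (p + p') (q + q') (r + r') (s + s').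
Proof. by apply/matrixP; apply: ord2_ind; apply: ord2_ind; rewrite !mxE. Qed.

Lemma mx22_scale a p q r s :
  a *: mx22 p q r s = mx22 (a * p) (a * q) (a * r) (a * s).
Proof. by apply/matrixP; apply: ord2_ind; apply: ord2_ind; rewrite !mxE. Qed.

Lemma mx22_sum (I : Type) (l : seq I) (p q r s : I -> R) :
  \sum_(i <- l) mx22 (p i) (q i) (r i) (s i) =
  mx22 (\sum_(i <- l) p i) (\sum_(i <- l) q i)
       (\sum_(i <- l) r i) (\sum_(i <- l) s i).
Proof.
by apply/matrixP; apply: ord2_ind; apply: ord2_ind; rewrite summxE !mxE;
  apply: eq_bigr => i _; rewrite mxE.
Qed.

Lemma mx22_1 : 1%:M = mx22 1 0 0 1.
Proof. by apply/matrixP; apply: ord2_ind; apply: ord2_ind; rewrite !mxE. Qed.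

Lemma det_mx22 p q r s : \det (mx22 p q r s) = p * s - q * r.
Proof.
rewrite (expand_det_row _ 0) !big_ord_recl big_ord0 /cofactor !det_mx11 !mxE /=.
by rewrite addr0 expr0 expr1 mul1r mulN1r mulrN.
Qed.

Lemma mx22_inj_entries p q r s p' q' r' s' :
  mx22 p q r s = mx22 p' q' r' s' -> [/\ p = p', q = q', r = r' & s = s'].
Proof.
by move=> E; split; [have := congr1 (fun M : 'M[R]_2 => M 0 0) E
  |have := congr1 (fun M : 'M[R]_2 => M 0 1) E
  |have := congr1 (fun M : 'M[R]_2 => M 1 0) E
  |have := congr1 (fun M : 'M[R]_2 => M 1 1) E]; rewrite !mxE.
Qed.

Definition symplectic : 'M[R]_2 := mx22 0 1 (-1) 0.

(** This is the source of all the powers of the determinant in the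
    transformation laws below. *)
Lemma symplectic_congruence (C : 'M[R]_2) :
  C *m symplectic *m C^T = \det C *: symplectic.
Proof.
rewrite [C]mx22E mx22_tr !mx22_mul det_mx22 mx22_scale; congr mx22; ring.
Qed.

End TwoByTwo.

Section NormalArea.
Context {R : comUnitRingType}.
Implicit Types (A : 'M[R]_(2, 4)) (x y : 'rV[R]_4).

(** The signed area of the projections of x and y to the normal plane, times the
    area spanned by the rows of A.  The rows of A and x, y together are oriented by
    the ambient space, so no orientation of the normal plane is involved. *)
Definition normal_area A x y : R :=
  \det (col_mx A (col_mx x y) : 'M[R]_(2 + (1 + 1))).

Lemma row'_eqP m n (M N : 'M[R]_(m, n)) i0 :
  (forall i, i != i0 -> row i M = row i N) -> row' i0 M = row' i0 N.
Proof.
move=> E; apply/row_matrixP => k; rewrite !row'Esub.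
have := E (lift i0 k); rewrite eq_sym neq_lift => /(_ isT)/rowP E'.
by apply/rowP => j; have := E' j; rewrite !mxE.
Qed.

Lemma normal_area_linearl A y (a b : R) x x' :
  normal_area A (a *: x + b *: x') y =
  a * normal_area A x y + b * normal_area A x' y.
Proof.
apply: (determinant_multilinear (i0 := rshift 2 (lshift 1 0))).
- by rewrite !rowKd !rowKu !linearP /= !linearZ /= !row_id.
- apply: row'_eqP => i; case: (split_ordP i) => j -> ; rewrite ?rowKu ?rowKd //.
  by case: (split_ordP j) => l ->; rewrite ?rowKu ?rowKd // ord1 eqxx.
- apply: row'_eqP => i; case: (split_ordP i) => j -> ; rewrite ?rowKu ?rowKd //.
  by case: (split_ordP j) => l ->; rewrite ?rowKu ?rowKd // ord1 eqxx.
Qed.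

Lemma normal_area_linearr A x (a b : R) y y' :
  normal_area A x (a *: y + b *: y') =
  a * normal_area A x y + b * normal_area A x y'.
Proof.
apply: (determinant_multilinear (i0 := rshift 2 (rshift 1 0))).
- by rewrite !rowKd !linearP /= !linearZ /= !row_id.
- apply: row'_eqP => i; case: (split_ordP i) => j -> ; rewrite ?rowKu ?rowKd //.
  by case: (split_ordP j) => l ->; rewrite ?rowKu ?rowKd // ord1 eqxx.
- apply: row'_eqP => i; case: (split_ordP i) => j -> ; rewrite ?rowKu ?rowKd //.
  by case: (split_ordP j) => l ->; rewrite ?rowKu ?rowKd // ord1 eqxx.
Qed.

Lemma normal_area_alternate A x : normal_area A x x = 0.
Proof.
apply: (determinant_alternate (i1 := rshift 2 (lshift 1 0))
  (i2 := rshift 2 (rshift 1 0))) => // j.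
by rewrite !col_mxEd !(col_mxEu, col_mxEd).
Qed.

Lemma normal_area_antisym A x y : normal_area A y x = - normal_area A x y.
Proof.
have := normal_area_alternate A (1 *: x + 1 *: y).
rewrite normal_area_linearl !normal_area_linearr !normal_area_alternate !mul1r.
by rewrite add0r addr0 addrC => /eqP; rewrite addr_eq0 => /eqP.
Qed.

Lemma normal_area_sum A x y : normal_area A x y =
  \sum_c \sum_d normal_area A (delta_mx 0 c) (delta_mx 0 d) * (x 0 c * y 0 d).
Proof.
have suml (I : Type) (r : seq I) (f : I -> R) (g : I -> 'rV[R]_4) z :
    normal_area A (\sum_(i <- r) f i *: g i) z = \sum_(i <- r) f i * normal_area A (g i) z.
  elim: r => [|i r IHr]; first by rewrite !big_nil -(scale0r 0) -[_ *: _]addr0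
    -{2}(scale0r 0) normal_area_linearl !mul0r addr0.
  by rewrite !big_cons -IHr -[X in _ + X]scale1r normal_area_linearl mul1r.
have sumr (I : Type) (r : seq I) (f : I -> R) (g : I -> 'rV[R]_4) z :
    normal_area A z (\sum_(i <- r) f i *: g i) = \sum_(i <- r) f i * normal_area A z (g i).
  by rewrite normal_area_antisym suml -sumrN; apply: eq_bigr => i _;
    rewrite -mulrN -normal_area_antisym.
rewrite {1}(row_sum_delta x) suml; apply: eq_bigr => c _.
rewrite {1}(row_sum_delta y) sumr mulr_sumr; apply: eq_bigr => d _; ring.
Qed.

Lemma normal_area_mul A (J : 'M[R]_2) x y :
  normal_area (J *m A) x y = \det J * normal_area A x y.
Proof.
rewrite /normal_area -[\det J]mulr1 -(det1 R (1 + 1)) -(det_ublock J 0).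
by rewrite -det_mulmx mul_block_col mul0mx addr0 mul0mx add0r mul1mx.
Qed.

End NormalArea.

(** * The Lorentz form of a second fundamental form *)

Section LorentzForm.
Context {R : realType}.
Implicit Types (A : 'M[R]_(2, 4)) (h : 'I_4 -> 'M[R]_2) (C : 'M[R]_2).

(** The Jacobian of two binary quadratic forms h, k has the matrix
    h symplectic k, up to symmetrization; here it is contracted with the normal
    area.  In an adapted frame it is a multiple of X_1^* X_2^*. *)
Definition jacobian_form A h : 'M[R]_2 :=
  \sum_c \sum_d normal_area A (delta_mx 0 c) (delta_mx 0 d) *:
    (h c *m symplectic *m h d).

(** The third fundamental form, sum of the squares of the shape operators. *)
Definition third_form A h : 'M[R]_2 :=
  \sum_c h c *m invmx (A *m A^T) *m h c.

(** The Jacobian of the two forms above, symmetrized so that it is a quadratic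
    form for every h. *)
Definition lorentz_form A h : 'M[R]_2 :=
  let X := third_form A h *m symplectic *m jacobian_form A h in X + X^T.

Lemma lorentz_form_sym A h : (lorentz_form A h)^T = lorentz_form A h.
Proof. by rewrite /lorentz_form linearD /= trmxK addrC. Qed.

Lemma congruence_invmx n (C I : 'M[R]_n) : C \in unitmx -> I \in unitmx ->
  invmx (C *m I *m C^T) = invmx C^T *m invmx I *m invmx C.
Proof.
move=> uC uI; have uCT : C^T \in unitmx by rewrite unitmx_tr.
have E : C *m I *m C^T *m (invmx C^T *m invmx I *m invmx C) = 1%:M.
  by rewrite -!mulmxA mulKVmx // mulKVmx // mulmxV.
have uM : C *m I *m C^T \in unitmx by rewrite !unitmx_mul uC uI.
by rewrite -[LHS]mulmx1 -E mulKmx.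
Qed.

Lemma gram_mul m n (C : 'M[R]_m) (A : 'M[R]_(m, n)) :
  (C *m A) *m (C *m A)^T = C *m (A *m A^T) *m C^T.
Proof. by rewrite trmx_mul !mulmxA. Qed.

Lemma congruence_mixed n (C I h k : 'M[R]_n) : C \in unitmx -> I \in unitmx ->
  (C *m h *m C^T) *m invmx (C *m I *m C^T) *m (C *m k *m C^T) =
  C *m (h *m invmx I *m k) *m C^T.
Proof.
move=> uC uI; have uCT : C^T \in unitmx by rewrite unitmx_tr.
by rewrite congruence_invmx // -!mulmxA mulKVmx // mulKmx.
Qed.

(** Each occurrence of [symplectic] and of the normal area contributes a factor
    det C: two from [jacobian_form] and one more from its product with
    [third_form]. *)
Lemma lorentz_form_congruence C A h : C \in unitmx -> row_free A ->
  lorentz_form (C *m A) (fun c => C *m h c *m C^T) =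
  \det C ^+ 3 *: (C *m lorentz_form A h *m C^T).
Proof.
move=> uC fA; have uI := gram_unit fA.
have thirdE : third_form (C *m A) (fun c => C *m h c *m C^T) =
    C *m third_form A h *m C^T.
  rewrite /third_form mulmx_sumr mulmx_suml; apply: eq_bigr => c _.
  by rewrite gram_mul congruence_mixed.
have omega (M N : 'M[R]_2) : (C *m M *m C^T) *m symplectic *m (C *m N *m C^T) =
    \det C *: (C *m (M *m symplectic *m N) *m C^T).
  have E : C^T *m symplectic *m C = \det C *: symplectic.
    by rewrite -{2}(trmxK C) symplectic_congruence det_tr.
  rewrite -!mulmxA [C^T *m (symplectic *m _)]mulmxA [C^T *m symplectic *m (C *m _)]mulmxA.
  by rewrite E -!scalemxAl -!scalemxAr !mulmxA.
have jacE : jacobian_form (C *m A) (fun c => C *m h c *m C^T) =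
    \det C ^+ 2 *: (C *m jacobian_form A h *m C^T).
  rewrite /jacobian_form mulmx_sumr mulmx_suml scaler_sumr; apply: eq_bigr => c _.
  rewrite mulmx_sumr mulmx_suml scaler_sumr; apply: eq_bigr => d _.
  rewrite omega normal_area_mul -scalemxAr -scalemxAl !scalerA; congr (_ *: _); ring.
rewrite /lorentz_form thirdE jacE -scalemxAr omega scalerA -exprSr.
move: (third_form A h *m symplectic *m jacobian_form A h) => X.
rewrite linearZ /= !trmx_mul trmxK mulmxDr mulmxDl scalerDr.
by rewrite mulmxA.
Qed.

(** The rows of C are the coefficients of an orthonormal tangent frame that
    diagonalizes the second fundamental form, with diagonal values a and b. *)
Definition adapted_frame A h C (a b : 'rV[R]_4) : Prop :=
  [/\ C \in unitmx, (C *m A) *m (C *m A)^T = 1%:M,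
      forall c, C *m h c *m C^T = mx22 (a 0 c) 0 0 (b 0 c),
      [/\ a != 0, b != 0 & dot a b = 0]
    & A *m a^T = 0 /\ A *m b^T = 0].

(** The square of the determinant is the Gram determinant of the four rows,
    which is diagonal. *)
Lemma normal_area_orthogonal A a b : A *m A^T = 1%:M -> A *m a^T = 0 ->
  A *m b^T = 0 -> dot a b = 0 -> normal_area A a b ^+ 2 = dot a a * dot b b.
Proof.
move=> AA Aa Ab ab; rewrite expr2 -{2}[normal_area A a b]det_tr -det_mulmx.
have aA : a *m A^T = 0 by rewrite -[LHS]trmxK trmx_mul trmxK Aa trmx0.
have bA : b *m A^T = 0 by rewrite -[LHS]trmxK trmx_mul trmxK Ab trmx0.
rewrite tr_col_mx mul_col_row AA tr_col_mx mul_mx_row mul_col_mx Aa Ab aA bA.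
rewrite row_mx0 col_mx0 det_ublock det1 mul1r mul_col_row.
have -> : b *m a^T = 0 by apply/matrixP => i j; rewrite !ord1 [LHS]dotC ab mxE.
by rewrite det_ublock !det_mx11.
Qed.

Lemma lorentz_form_adapted A h C a b : row_free A -> adapted_frame A h C a b ->
  exists2 k : R, k != 0 &
    C *m lorentz_form A h *m C^T = k *: mx22 (dot a a) 0 0 (- dot b b).
Proof.
move=> fA [uC orth hE [a0 b0 ab] [Aa Ab]].
have uD : \det C != 0 by move: uC; rewrite unitmxE unitfE.
have Ca : C *m A *m a^T = 0 by rewrite -mulmxA Aa mulmx0.
have Cb : C *m A *m b^T = 0 by rewrite -mulmxA Ab mulmx0.
pose beta := normal_area (C *m A) a b.
have beta0 : beta != 0.
  rewrite -sqrf_eq0 normal_area_orthogonal // mulf_neq0 //.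
    by apply: contra a0 => /eqP/dot_eq0 ->.
  by apply: contra b0 => /eqP/dot_eq0 ->.
have key : lorentz_form (C *m A) (fun c => C *m h c *m C^T) =
    (2 * beta) *: mx22 (dot a a) 0 0 (- dot b b).
  have thirdE : third_form (C *m A) (fun c => C *m h c *m C^T) =
      mx22 (dot a a) 0 0 (dot b b).
    rewrite /third_form orth invmx1.
    under eq_bigr do rewrite hE mulmx1 mx22_mul !mul0r !mulr0 !addr0 !add0r.
    by rewrite mx22_sum !dotE !big1_eq.
  have jacE : jacobian_form (C *m A) (fun c => C *m h c *m C^T) =
      mx22 0 beta beta 0.
    rewrite /jacobian_form.
    transitivity (\sum_c \sum_d mx22 0
       (normal_area (C *m A) (delta_mx 0 c) (delta_mx 0 d) * (a 0 c * b 0 d))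
       (- (normal_area (C *m A) (delta_mx 0 c) (delta_mx 0 d) * (b 0 c * a 0 d))) 0).
      apply: eq_bigr => c _; apply: eq_bigr => d _.
      by rewrite !hE !mx22_mul mx22_scale; congr mx22; ring.
    under eq_bigr do rewrite mx22_sum.
    rewrite mx22_sum; congr mx22.
    - by rewrite big1 // => c _; rewrite big1.
    - by rewrite /beta normal_area_sum.
    - rewrite /beta -[RHS]opprK -normal_area_antisym normal_area_sum -sumrN.
      by apply: eq_bigr => c _; rewrite sumrN.
    - by rewrite big1 // => c _; rewrite big1.
  rewrite /lorentz_form thirdE jacE !mx22_mul mx22_tr mx22_add mx22_scale.
  by congr mx22; ring.
exists ((\det C ^+ 3)^-1 * (2 * beta)).
  by rewrite !mulf_neq0 ?invr_eq0 ?expf_neq0 // pnatr_eq0.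
rewrite -scalerA -key lorentz_form_congruence // scalerA mulVf ?scale1r //.
by rewrite expf_neq0.
Qed.

End LorentzForm.

(** * Simultaneous diagonalization *)

Section AdaptedFrame.
Context {R : realType}.
Implicit Types (A : 'M[R]_(2, 4)) (h : 'I_4 -> 'M[R]_2) (C : 'M[R]_2).

Lemma congruence_cancel n (C M N : 'M[R]_n) : C \in unitmx ->
  C *m M *m C^T = N -> M = invmx C *m N *m invmx C^T.
Proof.
by move=> uC <-; rewrite !mulmxA mulVmx // mul1mx mulmxK // unitmx_tr.
Qed.

(** Evaluate the positive definite form first at (1, 0) and then at (-q, p). *)
Lemma gram_det_gt0 A : row_free A -> 0 < \det (A *m A^T).
Proof.
move=> fA.
have [p [q [s E]]] : exists p q s, A *m A^T = mx22 p q q s.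
  exists ((A *m A^T) 0 0), ((A *m A^T) 0 1), ((A *m A^T) 1 1).
  rewrite {1}[A *m A^T]mx22E; congr mx22.
  by rewrite -[in LHS]gram_sym trmx_entry.
have pos (v : 'rV[R]_2) : v != 0 -> 0 < (v *m (A *m A^T) *m v^T) 0 0.
  move=> v0; have -> : v *m (A *m A^T) *m v^T = (v *m A) *m (v *m A)^T.
    by rewrite trmx_mul !mulmxA.
  rewrite lt_neqAle eq_sym dot_ge0 andbT; apply: contra v0 => /eqP/dot_eq0/eqP.
  by rewrite mulmx_free_eq0.
have val (x y : R) : ((\row_j [:: x; y]`_j) *m mx22 p q q s *m (\row_j [:: x; y]`_j)^T) 0 0 =
    x * (x * p + y * q) + y * (x * q + y * s).
  rewrite !mxE !big_ord_recl big_ord0 !mxE !big_ord_recl !big_ord0 !mxE /=; ring.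
rewrite E det_mx22; rewrite E in pos.
have p0 : 0 < p.
  have := pos (\row_j [:: 1; 0]`_j); rewrite val => H.
  have : 0 < 1 * (1 * p + 0 * q) + 0 * (1 * q + 0 * s) :> R.
    apply: H; apply/eqP => /rowP/(_ 0); rewrite !mxE /= => /eqP.
    by rewrite oner_eq0.
  by rewrite !mul0r !mul1r !addr0.
have : 0 < - q * (- q * p + p * q) + p * (- q * q + p * s) :> R.
  rewrite -val; apply: pos; apply/eqP => /rowP/(_ 1); rewrite !mxE /= => /eqP.
  by rewrite gt_eqF.
have -> : - q * (- q * p + p * q) + p * (- q * q + p * s) = p * (p * s - q * q) by ring.
by rewrite pmulr_rgt0.
Qed.

Lemma orthonormal_frame_exists A : row_free A ->
  exists2 C, C \in unitmx & (C *m A) *m (C *m A)^T = 1%:M.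
Proof.
move=> fA; have D0 := gram_det_gt0 fA.
have : exists p q s, [/\ A *m A^T = mx22 p q q s & 0 < p].
  exists ((A *m A^T) 0 0), ((A *m A^T) 0 1), ((A *m A^T) 1 1).
  split.
    rewrite {1}[A *m A^T]mx22E; congr mx22.
    by rewrite -[in LHS]gram_sym trmx_entry.
  have -> : (A *m A^T) 0 0 = dot (row 0 A) (row 0 A).
    by rewrite dotE mxE; apply: eq_bigr => i _; rewrite !mxE.
  rewrite lt_neqAle eq_sym dot_ge0 andbT; apply/eqP => /dot_eq0 r0.
  have : (basisv 0 : 'rV[R]_2) *m A == 0 by rewrite /basisv -rowE r0.
  rewrite mulmx_free_eq0 // => /eqP/rowP/(_ 0); rewrite !mxE !eqxx /= => /eqP.
  by rewrite oner_eq0.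
move=> [p [q [s [E p0]]]]; rewrite E det_mx22 in D0.
pose u := Num.sqrt p; pose w := Num.sqrt (p * s - q * q).
have u0 : u != 0 by rewrite gt_eqF // sqrtr_gt0.
have w0 : w != 0 by rewrite gt_eqF // sqrtr_gt0.
have u2 : p = u ^+ 2 by rewrite sqr_sqrtr // ltW.
have w2 : s = (w ^+ 2 + q * q) / u ^+ 2.
  by rewrite sqr_sqrtr ?ltW // -u2 subrK mulrC mulKf // gt_eqF.
(* The Gram-Schmidt process for a metric with matrix [[p, q], [q, s]]. *)
exists (mx22 u^-1 0 (- q / (u * w)) (u / w)).
  rewrite unitmxE det_mx22 unitfE mul0r subr0 mulrA mulVf // mul1r.
  by rewrite invr_eq0.
rewrite gram_mul E mx22_tr !mx22_mul mx22_1 w2 u2.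
by congr mx22; field; rewrite ?u0 ?w0.
Qed.

(** The rotation by half the angle that removes the off-diagonal coefficient q
    of a form with difference d of the diagonal ones; (s, t) is a unit vector
    along (d + sqrt (d^2 + 4 q^2), 2 q). *)
Lemma half_angle (d q : R) : q != 0 ->
  exists s t : R, s ^+ 2 + t ^+ 2 = 1 /\ (s ^+ 2 - t ^+ 2) * q - s * t * d = 0.
Proof.
move=> q0; pose r := Num.sqrt (d ^+ 2 + 4 * q ^+ 2).
have r2 : r ^+ 2 = d ^+ 2 + 4 * q ^+ 2.
  by rewrite sqr_sqrtr // addr_ge0 ?sqr_ge0 // mulr_ge0 ?sqr_ge0.
pose n := Num.sqrt ((d + r) ^+ 2 + (2 * q) ^+ 2).
have npos : 0 < (d + r) ^+ 2 + (2 * q) ^+ 2.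
  by rewrite ltr_wpDl ?sqr_ge0 // exprn_even_gt0 //= mulf_neq0 // pnatr_eq0.
have n0 : n != 0 by rewrite gt_eqF // sqrtr_gt0.
have n2 : n ^+ 2 = (d + r) ^+ 2 + (2 * q) ^+ 2 by rewrite sqr_sqrtr // ltW.
exists ((d + r) / n), (2 * q / n); split.
  by rewrite !expr_div_n -mulrDl -n2 divff // expf_neq0.
apply: (mulIf (expf_neq0 2 n0)); rewrite mul0r.
transitivity (((d + r) ^+ 2 - (2 * q) ^+ 2) * q - (d + r) * (2 * q) * d).
  by field.
transitivity (q * (r ^+ 2 - (d ^+ 2 + 4 * q ^+ 2))); first by ring.
by rewrite r2 subrr mulr0.
Qed.

(** After orthonormalizing, the symmetry of h_c h_d says that the vectors of
    off-diagonal entries and of differences of diagonal entries are parallel, so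
    that a single rotation diagonalizes all the h_c.  If a or b vanished, all the
    h_c would be multiples of one matrix. *)
Lemma adapted_frame_exists A h : row_free A ->
  (forall c, (h c)^T = h c) ->
  \sum_c \det (h c) = 0 ->
  (forall c d, (h c *m invmx (A *m A^T) *m h d)^T = h c *m invmx (A *m A^T) *m h d) ->
  (forall (b : 'rV[R]_4) (S : 'M[R]_2), ~ forall c, h c = b 0 c *: S) ->
  (forall k l, A *m (\row_c h c k l)^T = 0) ->
  exists C a b, adapted_frame A h C a b.
Proof.
move=> fA hsym gauss ricci rank2 tang.
have uI := gram_unit fA.
have [C1 uC1 orth1] := orthonormal_frame_exists fA.
pose h1 c := C1 *m h c *m C1^T.
have h1sym c : (h1 c)^T = h1 c by rewrite /h1 !trmx_mul trmxK hsym mulmxA.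
have ricci1 c d : (h1 c *m h1 d)^T = h1 c *m h1 d.
  have -> : h1 c *m h1 d = C1 *m (h c *m invmx (A *m A^T) *m h d) *m C1^T.
    rewrite -(congruence_mixed (h c) (h d) uC1 uI) -gram_mul orth1 invmx1 mulmx1.
    by [].
  by rewrite !trmx_mul trmxK; move: (ricci c d); rewrite !trmx_mul => ->; rewrite mulmxA.
pose p c := h1 c 0 0; pose q c := h1 c 0 1; pose r c := h1 c 1 1.
have h1E c : h1 c = mx22 (p c) (q c) (q c) (r c).
  rewrite {1}[h1 c]mx22E; congr mx22.
  by rewrite -[in LHS]h1sym trmx_entry.
(* Compare the two off-diagonal entries of h_c h_d. *)
have par c d : (p c - r c) * q d = q c * (p d - r d).
  have := ricci1 c d; rewrite !h1E mx22_mul mx22_tr => /mx22_inj_entries[_ E _ _].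
  have -> : (p c - r c) * q d = p c * q d + q c * r d - q c * r d - r c * q d by ring.
  by rewrite -E; ring.
have [s [t [st1 st0]]] : exists s t : R, s ^+ 2 + t ^+ 2 = 1 /\
    forall c, (s ^+ 2 - t ^+ 2) * q c - s * t * (p c - r c) = 0.
  have [[c0 qc0]|q0] := pselect (exists c, q c != 0).
    have [s [t [st1 st0]]] := half_angle (p c0 - r c0) qc0.
    exists s, t; split=> // c; apply: (mulIf qc0); rewrite mul0r mulrBl -!mulrA par.
    transitivity (q c * ((s ^+ 2 - t ^+ 2) * q c0 - s * t * (p c0 - r c0))).
      by ring.
    by rewrite st0 mulr0.
  exists 1, 0; split; first by rewrite expr0n /= addr0 expr1n.
  move=> c; have -> : q c = 0.
    by apply/eqP/negPn/negP => qc; apply: q0; exists c.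
  by rewrite !mulr0 mul0r subr0.
pose C2 := mx22 s t (- t) s.
have C2orth : C2 *m C2^T = 1%:M.
  rewrite mx22_tr mx22_mul mx22_1.
  by congr mx22; rewrite -?st1; ring.
have uC2 : C2 \in unitmx.
  by have := unitmx1 R 2; rewrite -C2orth unitmx_mul => /andP[].
have uC : C2 *m C1 \in unitmx by rewrite unitmx_mul uC2.
pose a : 'rV[R]_4 := \row_c (C2 *m h1 c *m C2^T) 0 0.
pose b : 'rV[R]_4 := \row_c (C2 *m h1 c *m C2^T) 1 1.
have diag c : C2 *m C1 *m h c *m (C2 *m C1)^T = mx22 (a 0 c) 0 0 (b 0 c).
  have -> : C2 *m C1 *m h c *m (C2 *m C1)^T = C2 *m h1 c *m C2^T.
    by rewrite /h1 trmx_mul !mulmxA.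
  have off := st0 c; rewrite {1}[C2 *m h1 c *m C2^T]mx22E; congr mx22.
  - by rewrite [RHS]mxE.
  - by rewrite h1E mx22_tr !mx22_mul mxE /= -[RHS]off; ring.
  - by rewrite h1E mx22_tr !mx22_mul mxE /= -[RHS]off; ring.
  - by rewrite [RHS]mxE.
have ab : dot a b = 0.
  transitivity (\det (C2 *m C1) ^+ 2 * \sum_c \det (h c)); last by rewrite gauss mulr0.
  rewrite dotE mulr_sumr; apply: eq_bigr => c _.
  have := congr1 determinant (diag c); rewrite !det_mulmx det_tr det_mx22 mulr0 subr0.
  by move=> <-; rewrite det_mulmx; ring.
have hC c : h c = invmx (C2 *m C1) *m mx22 (a 0 c) 0 0 (b 0 c) *m invmx (C2 *m C1)^T.
  exact: congruence_cancel uC (diag c).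
have a0 : a != 0.
  apply/eqP => a0; apply: (rank2 b (invmx (C2 *m C1) *m mx22 0 0 0 1 *m invmx (C2 *m C1)^T)).
  move=> c; rewrite hC a0 scalemxAl scalemxAr mx22_scale [(0 : 'rV_4) 0 c]mxE.
  by rewrite !mulr0 mulr1.
have b0 : b != 0.
  apply/eqP => b0; apply: (rank2 a (invmx (C2 *m C1) *m mx22 1 0 0 0 *m invmx (C2 *m C1)^T)).
  move=> c; rewrite hC b0 scalemxAl scalemxAr mx22_scale [(0 : 'rV_4) 0 c]mxE.
  by rewrite !mulr0 mulr1.
have tangC i j : A *m (\row_c (C2 *m C1 *m h c *m (C2 *m C1)^T) i j)^T = 0.
  move: (C2 *m C1) => C.
  have -> : (\row_c (C *m h c *m C^T) i j)^T =
      \sum_k \sum_l (C i l * C j k) *: (\row_c h c l k)^T.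
    apply/matrixP => c z; rewrite summxE mxE mxE mxE; apply: eq_bigr => k _.
    rewrite summxE mxE mulr_suml; apply: eq_bigr => l _; rewrite !mxE; ring.
  rewrite mulmx_sumr big1 // => k _; rewrite mulmx_sumr big1 // => l _.
  by rewrite -scalemxAr tang scaler0.
exists (C2 *m C1), a, b; split=> //.
- by rewrite (_ : C2 *m C1 *m A = C2 *m (C1 *m A)) ?mulmxA // -mulmxA gram_mul orth1 mulmx1.
- split.
    rewrite -(tangC 0 0); congr (_ *m _^T); apply/rowP => c.
    by rewrite [RHS]mxE diag [RHS]mxE.
  rewrite -(tangC 1 1); congr (_ *m _^T); apply/rowP => c.
  by rewrite [RHS]mxE diag [RHS]mxE.
Qed.

Lemma lorentz_form_signature A h C a b (mu : R) : row_free A ->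
  adapted_frame A h C a b -> mu != 0 ->
  exists u v : 'rV[R]_2,
    [/\ bilin (mu *: lorentz_form A h) u u = 1,
        bilin (mu *: lorentz_form A h) v v = -1
      & bilin (mu *: lorentz_form A h) u v = 0].
Proof.
move=> fA fr mu0; have [k k0 kE] := lorentz_form_adapted fA fr.
have [_ _ _ [a0 b0 _] _] := fr.
have aa : 0 < dot a a.
  by rewrite lt_neqAle eq_sym dot_ge0 andbT; apply: contra a0 => /eqP/dot_eq0 ->.
have bb : 0 < dot b b.
  by rewrite lt_neqAle eq_sym dot_ge0 andbT; apply: contra b0 => /eqP/dot_eq0 ->.
pose m := mu * k; have m0 : m != 0 by rewrite mulf_neq0.
have val (x y x' y' : R) :
    bilin (mu *: lorentz_form A h) ((\row_j [:: x; y]`_j) *m C)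
      ((\row_j [:: x'; y']`_j) *m C) =
    m * (x * x' * dot a a - y * y' * dot b b).
  rewrite /bilin.
  have -> (X Y : 'rV[R]_2) : (X *m C) *m (mu *: lorentz_form A h) *m (Y *m C)^T =
      mu *: (X *m (C *m lorentz_form A h *m C^T) *m Y^T) :> 'M[R]_1.
    by rewrite trmx_mul -scalemxAr -scalemxAl !mulmxA.
  rewrite kE mx22_scale !mxE !big_ord_recl big_ord0 !mxE !big_ord_recl !big_ord0 !mxE /=.
  by rewrite /m; ring.
have inv_sq (z : R) : 0 < z -> exists x : R, x * x * z = 1.
  move=> z0; exists (Num.sqrt z)^-1.
  by rewrite -invfM -expr2 sqr_sqrtr ?ltW // mulVf // gt_eqF.
have [m_gt0|m_le0] := ltrP 0 m.
  have [x xE] := inv_sq (m * dot a a) (mulr_gt0 m_gt0 aa).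
  have [y yE] := inv_sq (m * dot b b) (mulr_gt0 m_gt0 bb).
  exists ((\row_j [:: x; 0]`_j) *m C), ((\row_j [:: 0; y]`_j) *m C).
  by split; rewrite val; [rewrite -[RHS]xE|rewrite -[in RHS]yE|]; ring.
have m_lt0 : 0 < - m by rewrite oppr_gt0 lt_neqAle m0.
have [x xE] := inv_sq (- m * dot a a) (mulr_gt0 m_lt0 aa).
have [y yE] := inv_sq (- m * dot b b) (mulr_gt0 m_lt0 bb).
exists ((\row_j [:: 0; y]`_j) *m C), ((\row_j [:: x; 0]`_j) *m C).
by split; rewrite val; [rewrite -[RHS]yE|rewrite -[in RHS]xE|]; ring.
Qed.

(** The second fundamental form in the normal direction N. *)
Definition height_form (h : 'I_4 -> 'M[R]_2) (N : 'rV[R]_4) : 'M[R]_2 :=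
  \sum_c N 0 c *: h c.

Lemma height_form_adapted A h C a b N : adapted_frame A h C a b ->
  C *m height_form h N *m C^T = mx22 (dot a N) 0 0 (dot b N).
Proof.
move=> [_ _ hE _ _]; rewrite /height_form mulmx_sumr mulmx_suml.
rewrite (eq_bigr (fun c => mx22 (a 0 c * N 0 c) 0 0 (b 0 c * N 0 c))) => [|c _].
  by rewrite mx22_sum !dotE !big1_eq.
by rewrite -scalemxAr -scalemxAl hE mx22_scale !mulr0 ![N 0 c * _]mulrC.
Qed.

(** The rows of A, N and M form an orthonormal basis, and x has no component
    along the rows of A. *)
Lemma dot_orthonormal_basis A (N M x y : 'rV[R]_4) : A *m A^T = 1%:M ->
  A *m N^T = 0 -> A *m M^T = 0 -> dot N N = 1 -> dot M M = 1 -> dot N M = 0 ->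
  A *m x^T = 0 -> dot x y = dot x N * dot y N + dot x M * dot y M.
Proof.
move=> AA AN AM NN MM NM Ax.
pose Q : 'M[R]_(2 + (1 + 1)) := col_mx A (col_mx N M).
have tr0 (z : 'rV[R]_4) : A *m z^T = 0 -> z *m A^T = 0.
  by move=> Az; rewrite -[LHS]trmxK trmx_mul trmxK Az trmx0.
have d11 (u v : 'rV[R]_4) : u *m v^T = (dot u v)%:M.
  by apply/matrixP => i j; rewrite !ord1 [RHS]mxE eqxx.
have QQ : Q *m Q^T = 1%:M.
  rewrite /Q tr_col_mx mul_col_row AA tr_col_mx mul_mx_row mul_col_mx AN AM.
  rewrite !tr0 // mul_col_row !d11 NN MM NM dotC NM.
  rewrite row_mx0 col_mx0 !scalar_mx_block.
  by rewrite -[(0 : R)%:M]/((0 : R)%:M : 'M[R]_1) raddf0.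
have QTQ : Q^T *m Q = 1%:M by apply: mulmx1C.
have xy : x *m y^T = (x *m Q^T) *m (y *m Q^T)^T.
  by rewrite trmx_mul trmxK -!mulmxA [Q^T *m _]mulmxA QTQ mul1mx.
rewrite {1}/dot xy /Q tr_col_mx tr_col_mx !mul_mx_row (tr0 x Ax) !tr_row_mx.
by rewrite !mul_row_col mul0mx add0r !d11 !tr_scalar_mx -!scalar_mxM -raddfD mxE eqxx.
Qed.

(** With a1 = <a,N>, a2 = <a,M> and likewise b1, b2, the relation <a,b> = 0 reads
    a1 b1 + a2 b2 = 0, which makes diag (a1 a2, b1 b2) proportional to
    diag (|a|^2, - |b|^2); and a1 b1 is nonzero because S_N is invertible. *)
Lemma special_normal_proportional A h C a b N M : row_free A ->
  adapted_frame A h C a b ->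
  A *m N^T = 0 -> A *m M^T = 0 -> dot N N = 1 -> dot M M = 1 -> dot N M = 0 ->
  height_form h N \in unitmx ->
  exists2 k : R, k != 0 &
    height_form h N *m invmx (A *m A^T) *m height_form h M = k *: lorentz_form A h.
Proof.
move=> fA fr AN AM NN MM NM uS; have [k k0 kE] := lorentz_form_adapted fA fr.
have [uC orth hE [a0 b0 ab] [Aa Ab]] := fr.
have CT z : A *m z^T = 0 -> C *m A *m z^T = 0 by rewrite -mulmxA => ->; rewrite mulmx0.
have exp x y : A *m x^T = 0 -> dot x y = dot x N * dot y N + dot x M * dot y M.
  by move=> Ax; apply: (dot_orthonormal_basis y orth) => //; exact: CT.
have E : C *m (height_form h N *m invmx (A *m A^T) *m height_form h M) *m C^T =
    mx22 (dot a N * dot a M) 0 0 (dot b N * dot b M).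
  rewrite -congruence_mixed ?gram_unit // -gram_mul orth invmx1 mulmx1.
  rewrite !(height_form_adapted _ fr) mx22_mul.
  by rewrite !mulr0 !mul0r !addr0 !add0r.
have detS : dot a N * dot b N != 0.
  have : C *m height_form h N *m C^T \in unitmx.
    by rewrite !unitmx_mul uC uS unitmx_tr.
  by rewrite (height_form_adapted _ fr) unitmxE unitfE det_mx22 mulr0 subr0.
have := exp a b Aa; rewrite ab => /esym/eqP; rewrite addr_eq0 => /eqP abE.
have aM : dot a M != 0.
  by apply: contra detS => /eqP aM; rewrite abE aM mul0r oppr0.
have aN : dot a N != 0 by apply: contra detS => /eqP ->; rewrite mul0r.
have aa : dot a a != 0 by apply: contra a0 => /eqP/dot_eq0 ->.
have EK : mx22 (dot a N * dot a M) 0 0 (dot b N * dot b M) =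
    (dot a N * dot a M / dot a a) *: mx22 (dot a a) 0 0 (- dot b b).
  rewrite mx22_scale !mulr0 divfK //; congr mx22.
  apply: (mulfI aa).
  transitivity (dot a N * dot a M * - dot b b); last by field.
  rewrite (exp a a Aa) (exp b b Ab); apply/eqP; rewrite -subr_eq0.
  have -> : (dot a N * dot a N + dot a M * dot a M) * (dot b N * dot b M) -
      dot a N * dot a M * - (dot b N * dot b N + dot b M * dot b M) =
      (dot a N * dot b N + dot a M * dot b M) * (dot a N * dot b M + dot a M * dot b N).
    by ring.
  by rewrite abE addNr mul0r.
exists (dot a N * dot a M / dot a a / k).
  by rewrite !mulf_neq0 ?invr_eq0.
rewrite (congruence_cancel uC E) EK (congruence_cancel uC kE).
by rewrite -!scalemxAr -!scalemxAl scalerA divfK.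
Qed.

End AdaptedFrame.

(** * The second fundamental form in a chart *)

Section EntryAlgebra.
Context {R : comNzRingType}.

Lemma mul_tr_sym_entry n (X Y : 'M[R]_(2, n)) : X *m Y^T = Y *m X^T ->
  \sum_c X 0 c * Y 1 c = \sum_c X 1 c * Y 0 c.
Proof.
move=> /(congr1 (fun M : 'M[R]_2 => M 0 1)); rewrite !mxE => E.
transitivity (\sum_c X 0 c * Y^T c 1); first by apply: eq_bigr => c _; rewrite mxE.
by rewrite E; apply: eq_bigr => c _; rewrite mxE mulrC.
Qed.

Lemma mul_tr_mixed_entry m n (X Y : 'M[R]_(m, n)) (V G K : 'M[R]_m) k l c d :
  (forall i, G k i = X i c) -> (forall i, K i l = Y i d) ->
  (G *m V *m K) k l = (X^T *m V *m Y) c d.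
Proof.
move=> GX KY; rewrite !mxE; apply: eq_bigr => i _; rewrite KY; congr (_ * _).
by rewrite !mxE; apply: eq_bigr => j _; rewrite GX mxE.
Qed.

End EntryAlgebra.

Section ChartFacts.
Context {R : realType}.
Variables (U : set 'rV[R]_2) (F : 'rV[R]_2 -> 'rV[R]_4).
Hypothesis oU : open U.
Hypothesis sF : smooth_on U F.
Hypothesis fF : forall x, U x -> row_free ('J F x).

Definition hessian_form (x : 'rV[R]_2) (c : 'I_4) : 'M[R]_2 :=
  \matrix_(k, l) second_form_rows F k x l c.

Local Notation A := (fun x => 'J F x).
Local Notation I := (first_fundamental_form F).
Local Notation P := (fun x => normal_projector ('J F x)).
Local Notation L := (second_form_rows F).
Local Notation H := hessian_form.

Lemma hessian_formE x c k l : H x c k l = L k x l c.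
Proof. exact: mxE. Qed.

Lemma second_form_rows_sym x k l : U x -> row l (L k x) = row k (L l x).
Proof. by move=> Ux; rewrite /second_form_rows !row_mul (derive_jacobian_swap oU sF). Qed.

Lemma hessian_form_sym x c : U x -> (H x c)^T = H x c.
Proof.
move=> Ux; apply/matrixP => k l; rewrite trmx_entry !hessian_formE.
by rewrite -[LHS]row_entry second_form_rows_sym // row_entry.
Qed.

Lemma hessian_form_tangent x k l : U x -> A x *m (\row_c H x c k l)^T = 0.
Proof.
move=> Ux; have -> : \row_c H x c k l = row l (L k x).
  by apply/rowP => c; rewrite [LHS]mxE hessian_formE row_entry.
rewrite /second_form_rows row_mul trmx_mul normal_projector_sym mulmxA.
by rewrite mul_normal_projector ?mul0mx //; exact: fF.
Qed.

Lemma hessian_form_gauss x : U x ->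
  (forall l a b c, riemann I l a b c x = 0) -> \sum_c \det (H x c) = 0.
Proof.
move=> Ux flat.
have E := mul_tr_sym_entry (gauss_equation oU sF fF Ux flat).
transitivity (\sum_c (L 0 x 0 c * L 1 x 1 c - L 0 x 1 c * L 1 x 0 c)).
  by apply: eq_bigr => c _; rewrite {1}[H x c]mx22E det_mx22 !hessian_formE.
by rewrite sumrB E subrr.
Qed.

Lemma hessian_form_mixed x c d k l : U x ->
  (H x c *m invmx (I x) *m H x d) k l = ((L k x)^T *m invmx (I x) *m L l x) c d.
Proof.
move=> Ux; apply: mul_tr_mixed_entry => m; first exact: hessian_formE.
by rewrite -(hessian_formE x d l m) -[in LHS](hessian_form_sym d Ux) trmx_entry.
Qed.

Lemma hessian_form_ricci x c d : U x ->
  (forall w u v, normal_curvature F u v (fun y => normal_proj F y w) x = 0) ->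
  (H x c *m invmx (I x) *m H x d)^T = H x c *m invmx (I x) *m H x d.
Proof.
move=> Ux flat; have E := ricci_equation oU sF fF Ux flat.
have Ecd := congr1 (fun M : 'M[R]_4 => M c d) E.
apply/matrixP => k l; apply: etrans (trmx_entry _ _ _) _.
apply: etrans (hessian_form_mixed c d l k Ux) _.
apply: etrans _ (esym (hessian_form_mixed c d k l Ux)).
move: k l; apply: ord2_ind; apply: ord2_ind.
- exact: erefl.
- exact: esym Ecd.
- exact: Ecd.
- exact: erefl.
Qed.

(** Otherwise all the values of the second fundamental form would lie on the
    line spanned by b. *)
Lemma first_normal_space_rank x (b : 'rV[R]_4) (S : 'M[R]_2) : U x ->
  \dim (first_normal_space F x) = 2%N -> ~ forall c, H x c = b 0 c *: S.
Proof.
move=> Ux dim2 E.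
have sffE i j : second_fundamental_form F (basisv i) (basisv j) x = row j (L i x).
  rewrite /second_fundamental_form normal_projE /second_form_rows row_mul.
  by rewrite (row_derive_jacobian oU _ j (sF 2%N) Ux).
have : (first_normal_space F x <= <[b]>)%VS.
  apply/subv_sumP => i _; apply/subv_sumP => j _.
  rewrite -memvE sffE; apply/vlineP; exists (S i j); apply/rowP => c.
  by rewrite row_entry -hessian_formE E !mxE mulrC.
by move/dimvS; rewrite dim2 dim_vline; case: (b != 0).
Qed.

Lemma adapted_frame_at x : U x ->
  (forall l a b c, riemann I l a b c x = 0) ->
  (forall w u v, normal_curvature F u v (fun y => normal_proj F y w) x = 0) ->
  \dim (first_normal_space F x) = 2%N ->
  exists C a b, adapted_frame ('J F x) (H x) C a b.
Proof.
move=> Ux flat nflat dim2; apply: adapted_frame_exists.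
- exact: fF.
- by move=> c; exact: hessian_form_sym.
- exact: hessian_form_gauss.
- by move=> c d; exact: hessian_form_ricci.
- by move=> b S; exact: first_normal_space_rank.
- by move=> k l; exact: hessian_form_tangent.
Qed.

Lemma C_on_normal_area k (M : 'rV[R]_2 -> 'M[R]_(2, 4)) y z : C_on k U M ->
  C_on k U (fun x => normal_area (M x) y z : R^o).
Proof.
move=> cM; apply: (C_on_det oU); apply: (C_on_matrix oU) => i j.
case: (split_ordP i) => l ->.
  apply: C_on_ext (C_on_entry oU l j cM) => x.
  by rewrite col_mxEu.
apply: C_on_ext (C_on_cst oU k (col_mx y z l j : R^o)) => x.
by rewrite col_mxEd.
Qed.

Lemma smooth_hessian_form c : smooth_on U (fun x => H x c).
Proof.
move=> n; apply: (C_on_matrix oU) => k l.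
apply: C_on_ext (C_on_entry oU l c (second_form_rows_smooth oU sF fF k n)) => x.
exact: hessian_formE.
Qed.

Lemma smooth_lorentz_form : smooth_on U (fun x => lorentz_form (A x) (H x)).
Proof.
move=> n.
have cH c : C_on n U (fun x => H x c) by exact: smooth_hessian_form.
have cA : C_on n U A by exact: jacobian_smooth.
have cI : C_on n U (fun x => invmx (I x)) by exact: invmx_first_fundamental_form_smooth.
have cjac : C_on n U (fun x => jacobian_form (A x) (H x)).
  apply: (C_on_sum oU) => c; apply: (C_on_sum oU) => d.
  apply: (C_on_scale oU); first exact: C_on_normal_area.
  apply: (C_on_mulmx oU) => //; apply: (C_on_mulmx oU) => //; exact: C_on_cst.
have cthird : C_on n U (fun x => third_form (A x) (H x)).
  apply: (C_on_sum oU) => c; apply: (C_on_mulmx oU) => //.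
  exact: (C_on_mulmx oU).
have cX : C_on n U (fun x =>
    third_form (A x) (H x) *m symplectic *m jacobian_form (A x) (H x)).
  apply: (C_on_mulmx oU) => //; apply: (C_on_mulmx oU) => //; exact: C_on_cst.
by apply: (C_onD oU) => //; exact: C_on_trmx.
Qed.

Lemma smooth_det_gram_inv3 :
  smooth_on U (fun x => (Num.sqrt (\det (I x)))^-1 ^+ 3 : R^o).
Proof.
move=> n.
have cs : C_on n U (fun x => (Num.sqrt (\det (I x)))^-1 : R^o).
  apply: (C_onV oU) => [x Ux|].
    by rewrite gt_eqF // sqrtr_gt0; apply: gram_det_gt0; exact: fF.
  apply: (C_on_sqrt oU) => [x Ux|]; first by apply: gram_det_gt0; exact: fF.
  by apply: (C_on_det oU); exact: first_fundamental_form_smooth.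
apply: C_on_ext (C_onM oU cs (C_onM oU cs cs)) => x.
by rewrite !exprS expr0 mulr1.
Qed.

Lemma normal_proj_normal x w : U x -> normal_at F x (normal_proj F x w).
Proof.
move=> Ux u; have dF := smooth_differentiable sF Ux.
rewrite deriveEjacobian // normal_projE /dot trmx_mul mulmxA.
rewrite -[w *m _ *m _]mulmxA normal_projector_mul ?mulmx0 ?mul0mx ?mxE //.
exact: fF.
Qed.

Lemma smooth_normal_proj w : smooth_on U (fun x => normal_proj F x w).
Proof.
move=> n; apply: (@C_on_ext _ _ _ _ (fun x => w *m P x)) => [x|].
  exact: normal_projE.
by apply: (C_on_mulmx oU); [exact: C_on_cst|exact: normal_projector_smooth].
Qed.

Lemma normal_at_mulmx x w : U x -> normal_at F x w -> w *m (A x)^T = 0.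
Proof.
move=> Ux nw; have dF := smooth_differentiable sF Ux.
apply/rowP => k; rewrite mulmx_entry.
transitivity (dot w ('D_(basisv k) F x)); last by rewrite nw mxE.
by rewrite dotE; apply: eq_bigr => c _; rewrite trmx_entry jacobian_entry.
Qed.

(** Differentiate N A^T = 0; only the normal part of the derivative of A
    contributes to its product with N. *)
Lemma weingarten N x : smooth_on U N ->
  (forall y, U y -> N y *m (A y)^T = 0) -> U x ->
  'J N x *m (A x)^T = - height_form (H x) (N x).
Proof.
move=> sN nN Ux.
have dN := smooth_differentiable sN Ux.
have dA := smooth_differentiable (jacobian_smooth oU sF) Ux.
apply/row_matrixP => k; rewrite row_mul row_jacobian //.
have := derive_eq_on (basisv k) oU Ux nN.
rewrite (derive_mulmx _ dN (differentiable_trmx dA)) derive_cst.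
rewrite (derive_trmx _ dA) => /eqP; rewrite addr_eq0 => /eqP ->.
rewrite -{1}(normal_projector_id (nN x Ux)).
rewrite -(normal_projector_sym ('J F x)) -mulmxA -trmx_mul.
rewrite -/(second_form_rows F k x) linearN /=; congr (- _).
apply/rowP => l; apply: etrans (mulmx_entry _ _ _ _) _.
rewrite row_entry /height_form summxE.
by apply: eq_bigr => c _; rewrite trmx_entry [RHS]mxE hessian_formE.
Qed.

End ChartFacts.

(** * Change of coordinates *)

Lemma row_free_mull_unit (K : fieldType) m n (C : 'M[K]_m) (M : 'M[K]_(m, n)) :
  row_free (C *m M) -> C \in unitmx.
Proof.
move=> fCM; rewrite -row_free_unit /row_free eqn_leq rank_leq_row /=.
by rewrite -{1}(eqP fCM) mxrankM_maxl.
Qed.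

Lemma mul_projector_cancel (K : pzRingType) m n (X C : 'M[K]_m)
    (B M : 'M[K]_(m, n)) (P : 'M[K]_n) :
  B *m P = 0 -> (X *m B + C *m M) *m P = C *m (M *m P).
Proof. by move=> BP; rewrite mulmxDl -!mulmxA BP mulmx0 add0r. Qed.

Section ChangeOfParameters.
Context {R : realType}.
Local Notation E := 'rV[R]_2.

Lemma C_on_subset (W : normedModType R) k (U V : set E) (F : E -> W) :
  V `<=` U -> C_on k U F -> C_on k V F.
Proof.
move=> VU; elim: k F => [|k IHk] F /=; first by move=> cF x /VU; exact: cF.
by move=> [dF cF]; split=> [x /VU|v]; [exact: dF|apply: IHk; exact: cF].
Qed.

Lemma derive_comp (W : normedModType R) (G : E -> E) (F : E -> W) x v :
  differentiable G x -> differentiable F (G x) ->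
  'D_v (fun y => F (G y)) x = 'D_('D_v G x) F (G x).
Proof.
move=> dG dF; have dFG := differentiable_comp dG dF.
apply: etrans (deriveE v dFG) _; apply: etrans _ (esym (deriveE _ dF)).
rewrite (deriveE v dG).
exact: (congr1 (fun h : E -> W => h v) (diff_comp dG dF)).
Qed.

Lemma derive_coord_sum (W : normedModType R) (F : E -> W) x v :
  differentiable F x -> 'D_v F x = \sum_m v 0 m *: 'D_(basisv m) F x.
Proof.
move=> dF; apply: etrans (deriveE v dF) _.
rewrite {1}[v]row_sum_delta linear_sum; apply: eq_bigr => m _.
by rewrite linearZ (deriveE _ dF).
Qed.

Lemma jacobian_comp n (G : E -> E) (F : E -> 'rV[R]_n) x :
  differentiable G x -> differentiable F (G x) ->
  'J (F \o G) x = 'J G x *m 'J F (G x).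
Proof.
move=> dG dF; apply/row_matrixP => k.
have dFG := differentiable_comp dG dF.
apply: etrans (row_jacobian k dFG) _; rewrite row_mul (row_jacobian k dG).
by rewrite -(deriveEjacobian _ dF); exact: derive_comp.
Qed.

Variables (V : set E) (F G : E -> 'rV[R]_4) (tau : E -> E) (x : E).
Hypotheses (oV : open V) (Vx : V x).
Hypothesis FG : forall y, V y -> F y = G (tau y).
Hypothesis smooth_tau : smooth_on V tau.
Hypothesis fF : forall y, V y -> row_free ('J F y).

Variable U : set E.
Hypotheses (oU : open U) (sG : smooth_on U G).
Hypothesis tauU : forall y, V y -> U (tau y).
Hypothesis fG : forall y, U y -> row_free ('J G y).
Local Notation J := ('J tau x).

Lemma jacobian_reparam y : V y -> 'J F y = 'J tau y *m 'J G (tau y).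
Proof.
move=> Vy.
have dtau := smooth_differentiable smooth_tau Vy.
have dG := smooth_differentiable sG (tauU Vy).
rewrite -(jacobian_comp dtau dG).
have dGt := differentiable_comp dtau dG.
have dF : differentiable F y.
  by apply: (differentiable_eq_on oV Vy) dGt => z Vz; rewrite FG.
apply/row_matrixP => k; apply: etrans (row_jacobian k dF) _.
apply: etrans _ (esym (row_jacobian k dGt)).
by apply: (derive_eq_on _ oV Vy) => z Vz; rewrite FG.
Qed.

Lemma reparam_unit y : V y -> 'J tau y \in unitmx.
Proof.
by move=> Vy; apply: (row_free_mull_unit (M := 'J G (tau y)));
  rewrite -jacobian_reparam //; exact: fF.
Qed.

Lemma normal_projector_reparam n (K : 'M[R]_2) (M : 'M[R]_(2, n)) :
  K \in unitmx -> row_free M -> normal_projector (K *m M) = normal_projector M.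
Proof.
move=> uK fM; rewrite /normal_projector gram_mul congruence_invmx ?gram_unit //.
congr (_ - _); rewrite trmx_mul -!mulmxA mulKmx // mulKVmx ?mulmxA //.
by rewrite unitmx_tr.
Qed.

(** Differentiating A_F = J A_G o tau gives a term with the derivative of J,
    which is tangent and is killed by the normal projector. *)
Lemma second_form_rows_reparam k :
  second_form_rows F k x =
  J *m \sum_m J k m *: second_form_rows G m (tau x).
Proof.
have dtau := smooth_differentiable smooth_tau Vx.
have sJtau : smooth_on V (fun y => 'J tau y).
  by move=> n; apply: C_on_jacobian.
have dJtau := smooth_differentiable sJtau Vx.
have sJG : smooth_on U (fun y => 'J G y) by exact: jacobian_smooth.
have dJG := smooth_differentiable sJG (tauU Vx).
have dJGt : differentiable (fun y => 'J G (tau y)) x by exact: differentiable_comp.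
have DJGt : 'D_(basisv k) (fun y => 'J G (tau y)) x =
    \sum_m J k m *: 'D_(basisv m) (fun y => 'J G y) (tau x).
  apply: etrans (derive_comp (basisv k) dtau dJG) _.
  apply: etrans (derive_coord_sum _ dJG) _; apply: eq_bigr => m _.
  by rewrite -(row_jacobian k dtau) row_entry.
have DF := etrans (derive_eq_on (basisv k) oV Vx jacobian_reparam)
  (derive_mulmx (basisv k) dJtau dJGt).
have PF : normal_projector ('J F x) = normal_projector ('J G (tau x)).
  rewrite (jacobian_reparam Vx); apply: normal_projector_reparam.
    exact: reparam_unit.
  exact: fG (tauU Vx).
have JP : 'J G (tau x) *m normal_projector ('J G (tau x)) = 0.
  by apply: mul_normal_projector; exact: fG (tauU Vx).
apply: etrans (congr2 mulmx DF PF) _.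
apply: etrans (mul_projector_cancel _ _ _ JP) _; congr (_ *m _).
apply: etrans (congr1 (mulmx^~ _) DJGt) _.
apply: etrans (mulmx_suml _ _ _ _) _.
by apply: eq_bigr => m _; rewrite -scalemxAl.
Qed.

Lemma hessian_form_reparam c :
  hessian_form F x c = J *m hessian_form G (tau x) c *m J^T.
Proof.
have hG m l : hessian_form G (tau x) c m l = second_form_rows G m (tau x) l c.
  exact: hessian_formE.
have EF k l : hessian_form F x c k l =
    (J *m \sum_m J k m *: second_form_rows G m (tau x)) l c.
  by rewrite hessian_formE second_form_rows_reparam.
move: EF hG; move: (hessian_form F x c) (hessian_form G (tau x) c) J => HF HG K.
move: (fun m => second_form_rows G m (tau x)) => Lm EF hG.
apply/matrixP => k l; rewrite EF !mxE; apply: eq_bigr => n _.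
rewrite summxE !mxE [RHS]mulrC; congr (_ * _); apply: eq_bigr => m _.
by rewrite mxE hG.
Qed.

End ChangeOfParameters.

(** * Charts of an immersed surface *)

Section GramContinuity.
Context {R : realType}.

Lemma cvg_det n (T : Type) (F : set_system T) (M : T -> 'M[R]_n) (N : 'M[R]_n) :
  Filter F -> (forall i j, M z i j @[z --> F] --> N i j) ->
  \det (M z) @[z --> F] --> \det N.
Proof.
move=> FF cM; apply: cvg_big; first exact: add_continuous.
move=> s _; apply: cvgM; first exact: cvg_cst.
apply: cvg_big; first exact: mul_continuous.
by move=> i _; exact: cM.
Qed.

(** The determinant is jointly continuous in x and y and positive at
    (x0, x0). *)
Lemma gram_det_near (V : normedModType R) (A : V -> 'M[R]_(2, 4)) (x0 : V) :
  {for x0, continuous A} -> row_free (A x0) ->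
  exists2 d : R, 0 < d &
    forall x y, ball x0 d x -> ball x0 d y -> 0 < \det (A x *m (A y)^T).
Proof.
move=> cA fA.
have cE k c : A z k c @[z --> x0] --> A x0 k c.
  exact: (cvg_comp A (fun M : 'M[R]_(2, 4) => M k c) cA (@coord_continuous _ _ _ k c (A x0))).
have cdet : \det (A z.1 *m (A z.2)^T) @[z --> (x0, x0)] --> \det (A x0 *m (A x0)^T).
  apply: cvg_det => i j.
  rewrite mxE; under eq_cvg do rewrite mxE.
  apply: cvg_big; first exact: add_continuous.
  move=> c _; rewrite mxE; under eq_cvg do rewrite mxE.
  apply: cvgM.
    by apply: (cvg_comp (fun z : V * V => z.1) (fun z => A z i c) _ (cE i c));
      exact: cvg_fst.
  by apply: (cvg_comp (fun z : V * V => z.2) (fun z => A z j c) _ (cE j c));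
    exact: cvg_snd.
have /nbhs_ballP[d /= d0 dP] := cdet _ (lt_nbhsr (gram_det_gt0 fA)).
by exists d => // x y xd yd; apply: (dP (x, y)).
Qed.

End GramContinuity.

Section Atlas.
Context {R : realType} (S : surface R).
Implicit Types (i j : chart_index S) (p q : S).

Lemma open_rangei (i : chart_index S) : open (rangei i).
Proof. exact: range_open. Qed.

Lemma rangei_coordi (i : chart_index S) p : domi i p -> rangei i (coordi i p).
Proof. by move=> dp; exists p. Qed.

Lemma of_coord_coordi (i : chart_index S) p : domi i p ->
  of_coord (atlas i) (coordi i p) = p.
Proof. by move=> dp; exact: coordK. Qed.

Lemma domi_of_coord (i : chart_index S) x : rangei i x ->
  domi i (of_coord (atlas i) x).
Proof. by move=> [p dp <-]; rewrite of_coord_coordi. Qed.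

Lemma coordi_of_coord (i : chart_index S) x : rangei i x ->
  coordi i (of_coord (atlas i) x) = x.
Proof. by move=> [p dp <-]; rewrite of_coord_coordi. Qed.

Lemma nbhs_domi (i : chart_index S) p : domi i p -> nbhs p (domi i).
Proof. by move=> dp; apply: open_nbhs_nbhs; split=> //; exact: dom_open. Qed.

Lemma nbhs_of_coord (i : chart_index S) x (V : set S) : rangei i x ->
  nbhs (of_coord (atlas i) x) V ->
  exists2 W : set 'rV[R]_2, open W &
    W x /\ forall y, W y -> rangei i y /\ V (of_coord (atlas i) y).
Proof.
move=> rx hV; have hW : nbhs x (rangei i `&` of_coord (atlas i) @^-1` V).
  apply: filterI; first by apply: open_nbhs_nbhs; split=> //; exact: open_rangei.
  exact: (of_coord_continuous rx).
exists (interior (rangei i `&` of_coord (atlas i) @^-1` V)).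
  exact: open_interior.
by split=> // y /nbhs_singleton[].
Qed.

Definition overlap (i j : chart_index S) : set 'rV[R]_2 :=
  Defs.coord (atlas i) @` (dom (atlas i) `&` dom (atlas j)).

Lemma overlapP i j x : overlap i j x <->
  rangei i x /\ domi j (of_coord (atlas i) x).
Proof.
split=> [[p [di dj] <-]|[rx dj]].
  by split; [exact: rangei_coordi|rewrite of_coord_coordi].
exists (of_coord (atlas i) x); last exact: coordi_of_coord.
by split=> //; exact: domi_of_coord.
Qed.

Lemma open_overlap i j : open (overlap i j).
Proof.
rewrite openE => x /overlapP[rx dj].
have [W oW [Wx WP]] := nbhs_of_coord rx (nbhs_domi dj).
apply: (filterS (P := W)); last exact: open_nbhs_nbhs.
by move=> y /WP ?; exact/overlapP.
Qed.

Lemma overlap_coordi i j p : domi i p -> domi j p -> overlap i j (coordi i p).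
Proof. by move=> di dj; exists p. Qed.

Lemma transition_coordi i j p : domi i p ->
  transition (atlas i) (atlas j) (coordi i p) = coordi j p.
Proof. by move=> di; rewrite /transition /= of_coord_coordi. Qed.

Lemma transition_rangei i j x : overlap i j x ->
  rangei j (transition (atlas i) (atlas j) x).
Proof. by move=> /overlapP[_ dj]; exact: rangei_coordi. Qed.

Lemma local_transition (W : Type) (F : S -> W) i j x : overlap i j x ->
  local F i x = local F j (transition (atlas i) (atlas j) x).
Proof.
by move=> /overlapP[_ dj]; rewrite /local /transition /= (of_coord_coordi dj).
Qed.

Section ImmersedFrames.
Variable f : S -> 'rV[R]_4.
Hypothesis imm : immersion f.

Lemma immersion_smooth i : smooth_on (rangei i) (local f i).
Proof. by have [sf _] := imm; exact: sf. Qed.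

Lemma immersion_free i x : rangei i x -> row_free ('J (local f i) x).
Proof. by move=> [p dp <-]; have [_ fp] := imm; exact: fp. Qed.

Definition frame_at i p : 'M[R]_(2, 4) := 'J (local f i) (coordi i p).

Lemma frame_at_free i p : domi i p -> row_free (frame_at i p).
Proof. by move=> dp; apply: immersion_free; exact: rangei_coordi. Qed.

Local Notation Jac i j p := ('J (transition (atlas i) (atlas j)) (coordi i p)).

Lemma frame_at_transition i j p : domi i p -> domi j p ->
  [/\ Jac i j p \in unitmx, frame_at i p = Jac i j p *m frame_at j p
    & forall c, hessian_form (local f i) (coordi i p) c =
        Jac i j p *m hessian_form (local f j) (coordi j p) c *m (Jac i j p)^T].
Proof.
move=> di dj; have ox := overlap_coordi di dj.
have lt := @local_transition _ f i j.
have st := atlas_smooth i j.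
have ff y : overlap i j y -> row_free ('J (local f i) y).
  by move=> /overlapP[ry _]; exact: immersion_free.
have oo := @open_overlap i j.
have tr := @transition_rangei i j.
have sj := immersion_smooth j.
have fj := @immersion_free j.
have oj := @open_rangei j.
split.
- exact: (reparam_unit oo lt st ff sj tr ox).
- rewrite /frame_at -(transition_coordi j di).
  exact: (jacobian_reparam oo lt st sj tr ox).
- move=> c; rewrite -(transition_coordi j di).
  exact: (hessian_form_reparam oo ox lt st ff oj sj tr fj c).
Qed.

(** The preimage in the chart of a small ball; the paths are straight segments
    in coordinates. *)
Lemma frame_at_near i p : domi i p ->
  exists2 U : set S, nbhs p U &
    [/\ U `<=` domi i,
        forall q r, U q -> U r -> 0 < \det (frame_at i q *m (frame_at i r)^T)
      & forall q, U q -> exists gamma : R -> S,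
       [/\ {within `[0, 1], continuous gamma}, gamma 0 = p, gamma 1 = q
         & forall t, 0 <= t <= 1 -> U (gamma t)]].
Proof.
move=> dp; set x0 := coordi i p; have rx0 : rangei i x0 := rangei_coordi dp.
have oi := @open_rangei i.
have cA : {for x0, continuous (fun x => 'J (local f i) x)}.
  exact: (jacobian_smooth oi (@immersion_smooth i) 0%N).
have [d1 d10 d1P] := gram_det_near cA (immersion_free rx0).
have /nbhs_ballP[d2 /= d20 d2P] : nbhs x0 (rangei i).
  by apply: open_nbhs_nbhs.
pose B := ball x0 (Order.min d1 d2).
have B0 : 0 < Order.min d1 d2 by rewrite lt_min d10.
have B1 x : B x -> ball x0 d1 x by apply: le_ball; rewrite ge_min lexx.
have B2 x : B x -> rangei i x.
  by move=> Bx; apply: d2P; apply: (le_ball _ Bx); rewrite ge_min lexx orbT.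
exists (domi i `&` coordi i @^-1` B).
  apply: filterI; first exact: nbhs_domi.
  by apply: (Defs.coord_continuous dp); exact: nbhsx_ballx.
split=> [q []//|q r [_ Bq] [_ Br]|q [dq Bq]].
  by apply: d1P; exact: B1.
pose y := coordi i q; pose z t := x0 + t *: (y - x0).
have Bz t : 0 <= t <= 1 -> B (z t).
  move=> /andP[t0 t1]; move: Bq; rewrite /B -!ball_normE /= -/y => Bq.
  rewrite /z opprD addNKr normrN normrZ ger0_norm // distrC in Bq *.
  by rewrite (le_lt_trans _ Bq) // ler_piMl.
exists (of_coord (atlas i) \o z); split.
- apply: continuous_in_subspaceT => t; rewrite inE /= in_itv /= => t01.
  apply: continuous_comp; last exact: (of_coord_continuous (B2 _ (Bz t t01))).
  by apply: cvgD; [exact: cvg_cst|apply: cvgZl; exact: cvg_id].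
- by rewrite /= /z scale0r addr0 of_coord_coordi.
- by rewrite /= /z scale1r addrC subrK of_coord_coordi.
- move=> t t01; have rz := B2 _ (Bz t t01); split.
    exact: domi_of_coord.
  by rewrite /= coordi_of_coord //; exact: Bz.
Qed.

End ImmersedFrames.
End Atlas.

(** * The canonical metric *)

Section CanonicalMetric.
Context {R : realType} (S : surface R).
Implicit Types (i j : chart_index S) (p q : S).
Variable f : S -> 'rV[R]_4.
Hypothesis imm : immersion f.

Local Notation Jac i j p := ('J (transition (atlas i) (atlas j)) (coordi i p)).

Lemma det_gram_mul (C D : 'M[R]_2) (A B : 'M[R]_(2, 4)) :
  \det ((C *m A) *m (D *m B)^T) = \det C * \det D * \det (A *m B^T).
Proof.
have -> : (C *m A) *m (D *m B)^T = C *m (A *m B^T) *m D^T.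
  by rewrite trmx_mul !mulmxA.
by rewrite !det_mulmx det_tr; ring.
Qed.

Lemma det_unit_neq0 n (M : 'M[R]_n) : M \in unitmx -> \det M != 0.
Proof. by rewrite unitmxE unitfE. Qed.

Lemma det_gram_mul_lt0 (C D : 'M[R]_2) (A B : 'M[R]_(2, 4)) :
  C \in unitmx -> D \in unitmx -> 0 < \det (A *m B^T) ->
  (\det ((C *m A) *m (D *m B)^T) < 0) = (\det C < 0) (+) (\det D < 0).
Proof.
move=> uC uD AB; rewrite det_gram_mul pmulr_llt0 // mulr_lt0.
by rewrite (det_unit_neq0 uC) (det_unit_neq0 uD).
Qed.

(** The second hypothesis says that b is a times the sign of det K, and the
    fourth power of a sign is 1. *)
Lemma congruence_rescale (K M : 'M[R]_2) (v a b : R) : \det K != 0 -> 0 < v ->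
  a * `|\det K| = b * \det K ->
  (a * (`|\det K| * v)^-1 ^+ 3) *: (\det K ^+ 3 *: (K *m M *m K^T)) =
  K *m ((b * v^-1 ^+ 3) *: M) *m K^T.
Proof.
move=> dK v0 E; rewrite -scalemxAr -scalemxAl scalerA; congr (_ *: _).
have aK : `|\det K| != 0 by rewrite normr_eq0.
have v1 : v != 0 by rewrite gt_eqF.
apply: (mulIf aK).
transitivity (a * `|\det K| * (\det K / `|\det K|) ^+ 3 * v^-1 ^+ 3).
  by field; rewrite aK v1.
rewrite E; transitivity (b * v^-1 ^+ 3 * (\det K ^+ 4 / `|\det K| ^+ 3)).
  by field; rewrite aK v1.
congr (_ * _); have -> : \det K ^+ 4 = `|\det K| ^+ 4.
  by rewrite -normrX ger0_norm // exprn_even_ge0.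
by field.
Qed.

Variable c : S -> chart_index S.
Hypothesis cP : forall p, domi (c p) p.

(** Whether the chart i and the chart c p chosen at p induce opposite
    orientations of the tangent plane at p, compared through its image in the
    ambient space. *)
Definition orientation_flip i p : bool :=
  \det (frame_at f (c p) p *m (frame_at f i p)^T) < 0.

Definition orientation_cocycle p q : bool :=
  \det (frame_at f (c p) p *m (frame_at f (c q) q)^T) < 0.

Lemma det_gram_frame_gt0 i p : domi i p ->
  0 < \det (frame_at f i p *m (frame_at f i p)^T).
Proof. by move=> di; apply: gram_det_gt0; exact: frame_at_free. Qed.

Lemma orientation_flipE i p : domi i p ->
  orientation_flip i p = (\det (Jac (c p) i p) < 0).
Proof.
move=> di; have [uJ E _] := frame_at_transition imm (cP p) di.
rewrite /orientation_flip E -[in X in _ *m X^T](mul1mx (frame_at f i p)).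
apply: etrans (det_gram_mul_lt0 uJ (unitmx1 _ _) (det_gram_frame_gt0 di)) _.
by rewrite det1 ltr10 addbF.
Qed.

Lemma orientation_cocycleE i q r : domi i q -> domi i r ->
  0 < \det (frame_at f i q *m (frame_at f i r)^T) ->
  orientation_cocycle q r = orientation_flip i q (+) orientation_flip i r.
Proof.
move=> dq dr qr; rewrite !orientation_flipE // /orientation_cocycle.
have [uq Eq _] := frame_at_transition imm (cP q) dq.
have [ur Er _] := frame_at_transition imm (cP r) dr.
rewrite Eq Er; exact: (det_gram_mul_lt0 uq ur qr).
Qed.

Lemma orientation_flip_transition i j p : domi i p -> domi j p ->
  orientation_flip i p = orientation_flip j p (+) (\det (Jac i j p) < 0).
Proof.
move=> di dj; have [uJ E _] := frame_at_transition imm di dj.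
have [uc Ec _] := frame_at_transition imm (cP p) dj.
rewrite [in RHS]orientation_flipE // /orientation_flip Ec E.
exact: (det_gram_mul_lt0 uc uJ (det_gram_frame_gt0 dj)).
Qed.

Variable s : S -> bool.
Hypothesis sP : forall p : S, exists2 U : set S, nbhs p U &
  forall q r, U q -> U r -> orientation_cocycle q r = s q (+) s r.

(** Whether the chart i agrees at p with the global orientation obtained by
    correcting the chosen chart at p by the sign s p. *)
Definition orientation_sign i p : R := (-1) ^+ (s p (+) orientation_flip i p).

Lemma orientation_sign_neq0 i p : orientation_sign i p != 0.
Proof. by rewrite signr_eq0. Qed.

Lemma orientation_sign_locally_constant i p : domi i p ->
  exists2 U : set S, nbhs p U &
    forall q, U q -> orientation_sign i q = orientation_sign i p.
Proof.
move=> dp; have [U hU [Ui Upos _]] := frame_at_near imm dp.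
have [V hV VP] := sP p; exists (U `&` V); first exact: filterI.
move=> q [Uq Vq].
have Up : U p := nbhs_singleton hU; have Vp : V p := nbhs_singleton hV.
have := orientation_cocycleE (Ui _ Uq) (Ui _ Up) (Upos _ _ Uq Up).
rewrite (VP _ _ Vq Vp) => E.
have {}E : s q (+) orientation_flip i q = s p (+) orientation_flip i p.
  move: E; move: (s q) (s p) (orientation_flip i q) (orientation_flip i p).
  by case=> [] [] [] [].
by rewrite /orientation_sign E.
Qed.

Lemma orientation_sign_transition i j p : domi i p -> domi j p ->
  orientation_sign i p * `|\det (Jac i j p)| =
  orientation_sign j p * \det (Jac i j p).
Proof.
move=> di dj; rewrite /orientation_sign (orientation_flip_transition di dj).
rewrite addbA signr_addb -mulrA; congr (_ * _).
have [d_lt0|d_ge0] := ltrP (\det (Jac i j p)) 0.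
  by rewrite ltr0_norm // expr1 mulN1r opprK.
by rewrite ger0_norm // expr0 mul1r.
Qed.

Definition gram_volume i x : R := Num.sqrt (\det (first_fundamental_form (local f i) x)).

Definition canonical_metric : tensor2 S := fun i x =>
  (orientation_sign i (of_coord (atlas i) x) * (gram_volume i x)^-1 ^+ 3) *:
  lorentz_form ('J (local f i) x) (hessian_form (local f i) x).

Lemma gram_volume_gt0 i x : rangei i x -> 0 < gram_volume i x.
Proof. by move=> rx; rewrite sqrtr_gt0; apply: gram_det_gt0; exact: immersion_free. Qed.

Lemma canonical_metric_smooth i : smooth_on (rangei i) (canonical_metric i).
Proof.
move=> k; apply: C_on_locally => x rx.
have dx := domi_of_coord rx.
have [U hU UP] := orientation_sign_locally_constant dx.
have [W oW [Wx WP]] := nbhs_of_coord rx hU.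
exists W => //.
have oi := @open_rangei _ S i; have si := immersion_smooth imm i.
have fi := @immersion_free _ S f imm i.
apply: (@C_on_eq _ _ oW _ _ (fun y =>
  (orientation_sign i (of_coord (atlas i) x) : R^o) *:
  ((gram_volume i y)^-1 ^+ 3 *:
  lorentz_form ('J (local f i) y) (hessian_form (local f i) y)))).
  by move=> y /WP[_ Uy]; rewrite /canonical_metric scalerA UP.
apply: (@C_on_subset _ _ _ (rangei i)); first by move=> y /WP[].
apply: (C_on_scale oi); first exact: C_on_cst.
apply: (C_on_scale oi); first exact: (smooth_det_gram_inv3 oi si fi).
exact: (smooth_lorentz_form oi si fi).
Qed.

Lemma canonical_metric_coordi i p : domi i p ->
  canonical_metric i (coordi i p) =
  (orientation_sign i p * (gram_volume i (coordi i p))^-1 ^+ 3) *: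
  lorentz_form (frame_at f i p) (hessian_form (local f i) (coordi i p)).
Proof. by move=> di; rewrite /canonical_metric (of_coord_coordi di). Qed.

(** The cube of det J coming from [lorentz_form] is compensated by the cube of
    |det J| in the volume and by the sign of det J in [orientation_sign]. *)
Lemma canonical_metric_transition i j p : domi i p -> domi j p ->
  canonical_metric i (coordi i p) =
  Jac i j p *m canonical_metric j (coordi j p) *m (Jac i j p)^T.
Proof.
move=> di dj; have [uJ EA EH] := frame_at_transition imm di dj.
have fj := frame_at_free imm dj.
have volE : gram_volume i (coordi i p) =
    `|\det (Jac i j p)| * gram_volume j (coordi j p).
  rewrite /gram_volume /first_fundamental_form -/(frame_at f i p) EA.
  rewrite det_gram_mul -expr2 sqrtrM ?sqr_ge0 // sqrtr_sqr.
  by [].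
have LE : lorentz_form ('J (local f i) (coordi i p)) (hessian_form (local f i) (coordi i p)) =
    \det (Jac i j p) ^+ 3 *: (Jac i j p *m
      lorentz_form (frame_at f j p) (hessian_form (local f j) (coordi j p)) *m
      (Jac i j p)^T).
  rewrite -lorentz_form_congruence // -EA -/(frame_at f i p); congr lorentz_form.
  by apply/funext => k; exact: EH.
have Ei := canonical_metric_coordi di; have Ej := canonical_metric_coordi dj.
apply: etrans Ei _; apply: etrans
  (congr2 (fun v M => (orientation_sign i p * v^-1 ^+ 3) *: M) volE LE) _.
apply: etrans _ (congr1 (fun M => Jac i j p *m M *m (Jac i j p)^T) (esym Ej)).
exact: (congruence_rescale _ (det_unit_neq0 uJ) (gram_volume_gt0 (rangei_coordi dj))
  (orientation_sign_transition di dj)).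
Qed.

End CanonicalMetric.

(** * Special sections and the main result *)

Lemma null_directions_scale (R : realType) (k : R) (G : 'M[R]_2) : k != 0 ->
  null_directions (k *: G) = null_directions G.
Proof.
move=> k0; have E v : bilin (k *: G) v v = k * bilin G v v.
  by rewrite /bilin -scalemxAr -scalemxAl mxE.
apply/seteqP; split=> v [v0 Gv]; split=> //.
  by apply: (mulfI k0); rewrite -E Gv mulr0.
by rewrite E Gv mulr0.
Qed.

Section SpecialSections.
Context {R : realType} (S : surface R).
Implicit Types (i : chart_index S) (p : S).
Variable f : S -> 'rV[R]_4.
Hypothesis imm : immersion f.

Lemma unit_normal_field_mulmx N i x : unit_normal_field f N -> rangei i x ->
  local N i x *m ('J (local f i) x)^T = 0.
Proof.
move=> [_ _ nN] rx; apply: (normal_at_mulmx (immersion_smooth imm i) rx).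
have := nN i _ (domi_of_coord rx); rewrite coordi_of_coord //.
Qed.

Lemma jacobian_unit_normal_field N i p : unit_normal_field f N -> domi i p ->
  'J (local N i) (coordi i p) *m (frame_at f i p)^T =
  - height_form (hessian_form (local f i) (coordi i p)) (N p).
Proof.
move=> uN di; have [sN _ _] := uN.
have := weingarten (@open_rangei _ S i) (immersion_smooth imm i) (sN i)
  (fun y ry => unit_normal_field_mulmx uN ry) (rangei_coordi di).
have E : local N i (coordi i p) = N p by rewrite /local /= (of_coord_coordi di).
move=> W; exact: etrans W (congr1 (fun z => - height_form _ z) E).
Qed.

Lemma height_form_hessian_sym i p (N : 'rV[R]_4) : domi i p ->
  (height_form (hessian_form (local f i) (coordi i p)) N)^T =
  height_form (hessian_form (local f i) (coordi i p)) N.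
Proof.
move=> di; rewrite /height_form linear_sum; apply: eq_bigr => k _.
rewrite linearZ /= (hessian_form_sym (@open_rangei _ S i)
  (immersion_smooth imm i)) //; exact: rangei_coordi.
Qed.

Lemma special_section_frame N i p : special_section f N -> domi i p ->
  exists M : 'M[R]_2, 'J (local N i) (coordi i p) = M *m frame_at f i p.
Proof.
move=> [[sN _ _] tN] di; have rx := rangei_coordi di.
have dN := smooth_differentiable (sN i) rx.
have df := smooth_differentiable (immersion_smooth imm i) rx.
have /choice[w wP] k : exists w : 'rV[R]_2,
    row k ('J (local N i) (coordi i p)) = w *m frame_at f i p.
  have [w wE] := tN i _ rx (basisv k); exists w.
  by apply: etrans (row_jacobian k dN) _; rewrite wE deriveEjacobian.
exists (\matrix_k w k); apply/row_matrixP => k.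
by rewrite row_mul rowK wP.
Qed.

(** Since N is parallel its Jacobian matrix is M A, where M I = - S_N by
    [weingarten]; the remaining factor A 'J Nh^T is - S_Nh, again by
    [weingarten]. *)
Lemma asymptotic_form N Nh i p : special_section f N ->
  orthonormal_complement f N Nh -> immersive_at N p -> domi i p ->
  height_form (hessian_form (local f i) (coordi i p)) (N p) \in unitmx /\
  dN_dNh N Nh i (coordi i p) =
    height_form (hessian_form (local f i) (coordi i p)) (N p)
    *m invmx (frame_at f i p *m (frame_at f i p)^T)
    *m height_form (hessian_form (local f i) (coordi i p)) (Nh p).
Proof.
move=> sN [uNh _] iN di; have [uN _] := sN.
have [M ME] := special_section_frame sN di.
have WN := jacobian_unit_normal_field uN di.
have WNh := jacobian_unit_normal_field uNh di.
have symNh := height_form_hessian_sym (Nh p) di.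
have uI := gram_unit (frame_at_free imm di).
have fN := iN i di; rewrite /dN_dNh.
move: (height_form _ (N p)) (height_form _ (Nh p)) WN WNh symNh => SN SNh WN WNh symNh.
move: ME WN WNh fN uI.
move: ('J (local N i) _) ('J (local Nh i) _) (frame_at f i p) => JN JNh A ME WN WNh fN uI.
have uM : M \in unitmx by apply: (row_free_mull_unit (M := A)); rewrite -ME.
have SNE : SN = - M *m (A *m A^T) by rewrite mulNmx mulmxA -ME WN opprK.
split.
  by rewrite SNE unitmx_mul -scaleN1r unitmxZ ?unitrN1 // uM.
rewrite SNE mulmxK // ME -mulmxA -[A *m JNh^T]trmxK trmx_mul trmxK WNh.
by rewrite linearN /= symNh mulmxN mulNmx.
Qed.

End SpecialSections.

Theorem lemma2 (R : realType) (S : surface R) (f : S -> 'rV[R]_4)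
    (hS : simply_connected R S)
    (hflat : flat_surface f)
    (hnormal : flat_normal_bundle f)
    (hN1 : forall p : S, first_normal_dim f 2 p) :
  exists L : set (tensor2 S),
    lorentz_surface_structure L /\
    forall g : tensor2 S, L g ->
    forall (p : S) (i : chart_index S), domi i p ->
    forall N Nh : S -> 'rV[R]_4,
      special_section f N -> orthonormal_complement f N Nh ->
      immersive_at N p ->
      null_directions (g i (coordi i p)) = asymptotic_directions N Nh i p.
Proof.
have [imm flat] := hflat.
have /choice[c cP] := @atlas_cover R S.
have [s sP] : exists s : S -> bool, forall p : S, exists2 U : set S, nbhs p U &
    forall q r, U q -> U r -> orientation_cocycle f c q r = s q (+) s r.
  apply: (locally_trivial_sign_cocycle hS) => p.
  have [U hU [Ui Upos Upath]] := frame_at_near imm (cP p).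
  exists U => //; split=> //; exists (orientation_flip f c (c p)) => q r Uq Ur.
  by apply: orientation_cocycleE => //; [exact: Ui|exact: Ui|exact: Upos].
pose g0 := canonical_metric f c s.
have adapted i p : domi i p -> exists C a b,
    adapted_frame (frame_at f i p) (hessian_form (local f i) (coordi i p)) C a b.
  move=> di; have rx := rangei_coordi di.
  apply: (adapted_frame_at (@open_rangei _ S i) (immersion_smooth imm i)
    (@immersion_free _ S f imm i) rx).
  - by move=> l a b d; exact: flat.
  - move=> w u v; apply: hnormal => //.
      exact: (smooth_normal_proj (@open_rangei _ S i) (immersion_smooth imm i)
        (@immersion_free _ S f imm i)).
    move=> y ry; exact: (normal_proj_normal (immersion_smooth imm i)
        (@immersion_free _ S f imm i)).
  - exact: hN1.
have scale0 i p : domi i p ->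
    orientation_sign f c s i p * (gram_volume f i (coordi i p))^-1 ^+ 3 != 0.
  move=> di; rewrite mulf_neq0 ?orientation_sign_neq0 // expf_neq0 // invr_eq0.
  by rewrite gt_eqF // gram_volume_gt0 //; exact: rangei_coordi.
have lor0 : lorentzian_metric g0.
  split.
    split; first by move=> i; exact: canonical_metric_smooth.
    by move=> i j p di dj; exact: canonical_metric_transition.
  move=> i x rx; have di := domi_of_coord rx.
  rewrite -(coordi_of_coord rx) /g0 canonical_metric_coordi //.
  have [C [a [b fr]]] := adapted _ _ di; split.
    by rewrite linearZ /= lorentz_form_sym.
  exact: (lorentz_form_signature (frame_at_free imm di) fr (scale0 _ _ di)).
exists [set h | lorentzian_metric h /\ conformal g0 h].
split; first by exists g0.
move=> g [_ [lambda [_ lambda0 gE]]] p i di N Nh sN oN iN.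
rewrite gE // null_directions_scale ?gt_eqF // /g0 canonical_metric_coordi //.
rewrite null_directions_scale ?scale0 // /asymptotic_directions.
have [uS ->] := asymptotic_form imm sN oN iN di.
have [C [a [b fr]]] := adapted _ _ di.
have [uN _] := sN; have [uNh NNh] := oN.
have normal M : unit_normal_field f M -> frame_at f i p *m (M p)^T = 0.
  move=> uM; have E : local M i (coordi i p) = M p.
    by rewrite /local /= (of_coord_coordi di).
  have := unit_normal_field_mulmx imm uM (rangei_coordi di); rewrite E => MA.
  by rewrite -[LHS]trmxK trmx_mul trmxK MA trmx0.
have [_ NN _] := uN; have [_ NhNh _] := uNh.
have [k k0 ->] := special_normal_proportional (frame_at_free imm di) fr
  (normal _ uN) (normal _ uNh) (NN p) (NhNh p) (NNh p) uS.
by rewrite null_directions_scale.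
Qed.
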